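(* Let $\mathbf{A}\in\mathbb{R}^{n\times d}$ have rank $r$ and let $\epsilon\in(0,1)$. Run Algorithm 4 (defined in the context) on $\mathbf{A}$ and $\epsilon$. Then the output $\widetilde{\mathbf{A}}_n$ is a $(1\pm\epsilon)$-spectral approximation for $\mathbf{A}$, and its expected number of rows is $\mathrm{O}\left(r\epsilon^{-2}\log\mu(\mathbf{A})+r\epsilon^{-2}\right)$.
   Context: For a matrix $\mathbf{A}\in\mathbb{R}^{n\times d}$, $\mathbf{a}_i^\top$ denotes its $i$-th row, $\mathbf{A}_i$ the matrix formed by its first $i$ rows, $\mathbf{M}^+$ the Moore–Penrose pseudo-inverse. $\widetilde{\mathbf{A}}$ is a $(1\pm\epsilon)$-spectral approximation for $\mathbf{A}$ if $(1-\epsilon)\mathbf{A}^\top\mathbf{A}\preceq\widetilde{\mathbf{A}}^\top\widetilde{\mathbf{A}}\preceq(1+\epsilon)\mathbf{A}^\top\mathbf{A}$. $\mu(\mathbf{A})=\|\mathbf{A}\|_2^2/\min_i\sigma_{\min}(\mathbf{A}_i)^2$, where $\sigma_{\min}$ is the smallest nonzero singular value and the minimum is over $i$ with $\mathbf{A}_i\ne\mathbf{O}$. Algorithm 4: set $c_U=2/\epsilon+1$, $c_L=3/\epsilon-1$, $\widetilde{\mathbf{A}}_0=\mathbf{O}$, $\mathbf{B}^U_0=\mathbf{B}^L_0=\mathbf{O}$ ($d\times d$). For $i=1,\dots,n$: let $\mathbf{X}^U_{i-1}=\mathbf{B}^U_{i-1}-\widetilde{\mathbf{A}}_{i-1}^\top\widetilde{\mathbf{A}}_{i-1}+\mathbf{a}_i\mathbf{a}_i^\top$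 and $\mathbf{X}^L_{i-1}=\widetilde{\mathbf{A}}_{i-1}^\top\widetilde{\mathbf{A}}_{i-1}-\mathbf{B}^L_{i-1}+\mathbf{a}_i\mathbf{a}_i^\top$; set $p_i=\min\left(c_U\mathbf{a}_i^\top(\mathbf{X}^U_{i-1})^+\mathbf{a}_i+c_L\mathbf{a}_i^\top(\mathbf{X}^L_{i-1})^+\mathbf{a}_i,1\right)$; with probability $p_i$ (independently) append the row $\mathbf{a}_i^\top/\sqrt{p_i}$ to $\widetilde{\mathbf{A}}_{i-1}$ to get $\widetilde{\mathbf{A}}_i$, otherwise $\widetilde{\mathbf{A}}_i=\widetilde{\mathbf{A}}_{i-1}$; then $\mathbf{B}^U_i=\mathbf{B}^U_{i-1}+(1+\epsilon)\mathbf{a}_i\mathbf{a}_i^\top$, $\mathbf{B}^L_i=\mathbf{B}^L_{i-1}+(1-\epsilon)\mathbf{a}_i\mathbf{a}_i^\top$. Output $\widetilde{\mathbf{A}}_n$. *)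

(* Defs.v *)
From HB Require Import structures.
From Stdlib Require Import Reals Lra ClassicalEpsilon FunctionalExtensionality.
From mathcomp Require Import all_boot all_order all_algebra.
Set Implicit Arguments. Unset Strict Implicit. Unset Printing Implicit Defensive.

Definition Reqb (x y : R) : bool := if Req_EM_T x y then true else false.
Lemma ReqP : Equality.axiom Reqb.
Proof. move=> x y; rewrite /Reqb; case: Req_EM_T => h; by constructor. Qed.
HB.instance Definition _ := hasDecEq.Build R ReqP.

Definition Rfind (P : pred R) (n : nat) : option R :=
  match excluded_middle_informative (exists x, P x) with
  | left h => Some (proj1_sig (constructive_indefinite_description _ h))
  | right _ => None end.
Lemma Rfind_correct P n x : Rfind P n = Some x -> P x.
Proof. rewrite /Rfind; case: excluded_middle_informative => // h [<-].
exact: (proj2_sig (constructive_indefinite_description _ h)). Qed.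
Lemma Rfind_complete (P : pred R) : (exists x, P x) -> exists n, Rfind P n.
Proof. move=> h; exists 0%N; rewrite /Rfind.
case: excluded_middle_informative => [//|hn]; by case: (hn h). Qed.
Lemma Rfind_ext (P Q : pred R) : P =1 Q -> Rfind P =1 Rfind Q.
Proof. move=> h; have -> : P = Q by apply: functional_extensionality. by []. Qed.
HB.instance Definition _ := hasChoice.Build R Rfind_correct Rfind_complete Rfind_ext.

HB.instance Definition _ := GRing.isZmodule.Build R
  (fun x y z => esym (Rplus_assoc x y z)) Rplus_comm Rplus_0_l Rplus_opp_l.

Lemma R1_neq0 : (R1 != R0 :> R). Proof. by apply/eqP; exact: R1_neq_R0. Qed.
HB.instance Definition _ := GRing.Zmodule_isComNzRing.Build R
  (fun x y z => esym (Rmult_assoc x y z)) Rmult_comm Rmult_1_l Rmult_plus_distr_r R1_neq0.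

Local Open Scope ring_scope.
Definition Rinvx (x : R) : R := if x == 0 then 0 else Rinv x.
Lemma Rinvx_mulVf (x : R) : x != 0 -> Rinvx x * x = 1.
Proof. move=> hx; rewrite /Rinvx (negPf hx); apply: Rinv_l.
by move=> h; rewrite h eqxx in hx. Qed.
Lemma Rinvx0 : Rinvx 0 = 0. Proof. by rewrite /Rinvx eqxx. Qed.
HB.instance Definition _ := GRing.ComNzRing_isField.Build R Rinvx_mulVf Rinvx0.

Definition Rleb (x y : R) : bool := if Rle_dec x y then true else false.
Definition Rltb (x y : R) : bool := if Rlt_dec x y then true else false.
Lemma RlebP x y : reflect (Rle x y) (Rleb x y).
Proof. rewrite /Rleb; case: Rle_dec => h; by constructor. Qed.
Lemma RltbP x y : reflect (Rlt x y) (Rltb x y).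
Proof. rewrite /Rltb; case: Rlt_dec => h; by constructor. Qed.

Lemma Rle0_add (x y : R) : Rleb 0 x -> Rleb 0 y -> Rleb 0 (x + y).
Proof. move=> /RlebP hx /RlebP hy; apply/RlebP; rewrite /GRing.add /=; lra. Qed.
Lemma Rle0_mul (x y : R) : Rleb 0 x -> Rleb 0 y -> Rleb 0 (x * y).
Proof. move=> /RlebP hx /RlebP hy; apply/RlebP; rewrite /GRing.mul /=.
exact: Rmult_le_pos. Qed.
Lemma Rle0_anti (x : R) : Rleb 0 x -> Rleb x 0 -> x = 0.
Proof. move=> /RlebP hx /RlebP hy; apply: Rle_antisym => //. Qed.
Lemma Rsub_ge0 (x y : R) : Rleb 0 (y - x) = Rleb x y.
Proof. apply/RlebP/RlebP; rewrite /GRing.add /GRing.opp /=; lra. Qed.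
Lemma Rle0_total (x : R) : Rleb 0 x || Rleb x 0.
Proof. case: (Rle_dec 0 x) => h; [apply/orP; left|apply/orP; right]; apply/RlebP; lra. Qed.
Lemma RnormN (x : R) : Rabs (- x) = Rabs x.
Proof. exact: Rabs_Ropp. Qed.
Lemma Rge0_norm (x : R) : Rleb 0 x -> Rabs x = x.
Proof. move=> /RlebP h; exact: Rabs_pos_eq. Qed.
Lemma Rlt_def (x y : R) : Rltb x y = (y != x) && Rleb x y.
Proof. apply/RltbP/andP => [h|[/eqP h1 /RlebP h2]]; last by lra.
split; [apply/eqP; lra| apply/RlebP; lra]. Qed.
HB.instance Definition _ := Num.IntegralDomain_isLeReal.Build R
  Rle0_add Rle0_mul Rle0_anti Rsub_ge0 Rle0_total RnormN Rge0_norm Rlt_def.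



Definition loewner_le (d : nat) (M N : 'M[R]_d) : Prop :=
  forall x : 'rV[R]_d, 0 <= (x *m (N - M) *m x^T) 0 0.

Definition spectral_approx (m n d : nat) (At : 'M[R]_(m, d)) (A : 'M[R]_(n, d))
    (eps : R) : Prop :=
  loewner_le ((1 - eps) *: (A^T *m A)) (At^T *m At) /\
  loewner_le (At^T *m At) ((1 + eps) *: (A^T *m A)).

Definition is_MP_pinv (m n : nat) (M : 'M[R]_(m, n)) (P : 'M[R]_(n, m)) : Prop :=
  [/\ M *m P *m M = M, P *m M *m P = P, (M *m P)^T = M *m P & (P *m M)^T = P *m M].

Definition pinv (m n : nat) (M : 'M[R]_(m, n)) : 'M[R]_(n, m) :=
  epsilon (inhabits 0) (is_MP_pinv M).

(* maximum / minimum of a subset of R (used only on finite nonempty sets) *)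
Definition max_of (P : R -> Prop) : R :=
  epsilon (inhabits 0) (fun x => P x /\ forall y, P y -> y <= x).
Definition min_of (P : R -> Prop) : R :=
  epsilon (inhabits 0) (fun x => P x /\ forall y, P y -> x <= y).

Definition singular_value (m d : nat) (M : 'M[R]_(m, d)) (s : R) : Prop :=
  0 <= s /\ eigenvalue (M^T *m M) (s ^+ 2).

Definition spec_norm (m d : nat) (M : 'M[R]_(m, d)) : R :=
  max_of (singular_value M).

Definition sigma_min (m d : nat) (M : 'M[R]_(m, d)) : R :=
  min_of (fun s => singular_value M s /\ 0 < s).

Definition first_rows (n d : nat) (A : 'M[R]_(n, d)) (i : 'I_n.+1) : 'M[R]_(i, d) :=
  \matrix_(k < i, j < d) A (widen_ord (ltn_ord i : (i <= n)%N) k) j.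

Definition mu (n d : nat) (A : 'M[R]_(n, d)) : R :=
  spec_norm A ^+ 2 /
  min_of (fun v => exists i : 'I_n.+1,
            first_rows A i != 0 /\ v = sigma_min (first_rows A i) ^+ 2).

Definition stack (d : nat) (s : seq 'rV[R]_d) : 'M[R]_(size s, d) :=
  \matrix_(k < size s, j < d) (nth 0 s k) 0 j.

Record alg_state (d : nat) := AlgState {
  st_rows : seq 'rV[R]_d;
  st_BU : 'M[R]_d;
  st_BL : 'M[R]_d
}.

Definition init_state (d : nat) : alg_state d := AlgState [::] 0 0.

Definition cU (eps : R) : R := 2 / eps + 1.
Definition cL (eps : R) : R := 3 / eps - 1.

(* a is the row a_i^T, so a_i a_i^T = a^T *m a and a_i^T M a_i = (a M a^T) *)
Definition quad (d : nat) (a : 'rV[R]_d) (M : 'M[R]_d) : R := (a *m M *m a^T) 0 0.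

Definition gram (d : nat) (s : seq 'rV[R]_d) : 'M[R]_d :=
  (stack s)^T *m stack s.

Definition XU (d : nat) (st : alg_state d) (a : 'rV[R]_d) : 'M[R]_d :=
  st_BU st - gram (st_rows st) + a^T *m a.
Definition XL (d : nat) (st : alg_state d) (a : 'rV[R]_d) : 'M[R]_d :=
  gram (st_rows st) - st_BL st + a^T *m a.

Definition prob (d : nat) (eps : R) (st : alg_state d) (a : 'rV[R]_d) : R :=
  Num.min (cU eps * quad a (pinv (XU st a)) + cL eps * quad a (pinv (XL st a))) 1.

Definition keep (d : nat) (eps : R) (st : alg_state d) (a : 'rV[R]_d) : alg_state d :=
  AlgState (rcons (st_rows st) ((sqrt (prob eps st a))^-1 *: a))
           (st_BU st + (1 + eps) *: (a^T *m a))
           (st_BL st + (1 - eps) *: (a^T *m a)).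

Definition skip (d : nat) (eps : R) (st : alg_state d) (a : 'rV[R]_d) : alg_state d :=
  AlgState (st_rows st)
           (st_BU st + (1 + eps) *: (a^T *m a))
           (st_BL st + (1 - eps) *: (a^T *m a)).

(* Expected number of rows of the output, when the algorithm is run from
   state st on the remaining input rows; the coin flips are independent and
   the i-th one is a Bernoulli(p_i) with p_i depending on the history. *)
Fixpoint expected_rows (d : nat) (eps : R) (st : alg_state d) (rs : seq 'rV[R]_d) : R :=
  match rs with
  | [::] => (size (st_rows st))%:R
  | a :: rs' =>
      prob eps st a * expected_rows eps (keep eps st a) rs'
      + (1 - prob eps st a) * expected_rows eps (skip eps st a) rs'
  end.

Fixpoint almost_surely (d : nat) (P : seq 'rV[R]_d -> Prop) (eps : R)
    (st : alg_state d) (rs : seq 'rV[R]_d) : Prop :=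
  match rs with
  | [::] => P (st_rows st)
  | a :: rs' =>
      (0 < prob eps st a -> almost_surely P eps (keep eps st a) rs') /\
      (0 < 1 - prob eps st a -> almost_surely P eps (skip eps st a) rs')
  end.

Definition rows_of (n d : nat) (A : 'M[R]_(n, d)) : seq 'rV[R]_d :=
  [seq row i A | i <- enum 'I_n].

(* Main.v *)
Require Import Defs.
From HB Require Import structures.
From Stdlib Require Import Reals.
From mathcomp Require Import all_boot all_order all_algebra.
From mathcomp Require Import complex.
From mathcomp Require Import ring lra.
Import Order.TTheory GRing.Theory Num.Theory.
Local Open Scope ring_scope.
Set Implicit Arguments. Unset Strict Implicit. Unset Printing Implicit Defensive.

(* The gaps Y^U = B^U - S and Y^L = S - B^L, with S the Gram matrix of the sample, stay
   positive semidefinite, which is the spectral approximation.  For the row count, fix a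
   future row w and a half-step h = eps/2, and compare the two leverages that determine
   the sampling probability of w with those in Y + h G + w w^T, where G is the Gram matrix
   of the rows still to be read before w.  When a row a is read, G loses a a^T while Y
   changes by a random multiple of a a^T; by Sherman-Morrison the choice of c_U and c_L
   makes the leverage of w a supermartingale.  Hence the expected number of rows is at
   most 5/eps times the sum of the leverages of a_j in h A_{j-1}^T A_{j-1} + a_j a_j^T.
   Dropping h costs a factor 2/eps; with lambda = min sigma_min^2, regularizing by
   lambda I costs a factor 2, and the regularized leverages telescope into log det(lambda I + A^T A) - log det(lambda I),
   which is at most r log(1 + mu(A)). *)

(** * Positive semidefinite forms and leverages *)

Section Bilinear.
Context {F : realFieldType} {d : nat}.
Implicit Types (M N X Y : 'M[F]_d) (x y z a b w : 'rV[F]_d) (c : F).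

Definition bil M x y : F := (x *m M *m y^T) 0 0.
Definition dot x y : F := (x *m y^T) 0 0.
Definition sqr a : 'M[F]_d := a^T *m a.
Definition sym M : Prop := M^T = M.
Definition psd M : Prop := sym M /\ forall x, 0 <= bil M x x.

Lemma dotE x y : dot x y = \sum_i x 0 i * y 0 i.
Proof. by rewrite /dot mxE; apply: eq_bigr => i _; rewrite mxE. Qed.
Lemma dotC x y : dot x y = dot y x.
Proof. by rewrite !dotE; apply: eq_bigr => i _; rewrite mulrC. Qed.
Lemma dotDl x y z : dot (x + y) z = dot x z + dot y z.
Proof. by rewrite /dot mulmxDl mxE. Qed.
Lemma dotZl c x y : dot (c *: x) y = c * dot x y.
Proof. by rewrite /dot -scalemxAl mxE. Qed.
Lemma dotBl x y z : dot (x - y) z = dot x z - dot y z.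
Proof. by rewrite -scaleN1r dotDl dotZl mulN1r. Qed.
Lemma dot0l x : dot 0 x = 0. Proof. by rewrite /dot mul0mx mxE. Qed.
Lemma dot_ge0 x : 0 <= dot x x.
Proof. by rewrite dotE; apply: sumr_ge0 => i _; rewrite -expr2 sqr_ge0. Qed.
Lemma dot_eq0 x : dot x x = 0 -> x = 0.
Proof.
rewrite dotE => /eqP; rewrite psumr_eq0; last by move=> i _; rewrite -expr2 sqr_ge0.
move=> /allP h; apply/rowP => i; rewrite mxE.
by have := h i (mem_index_enum i); rewrite /= mulf_eq0 orbb => /eqP.
Qed.

Lemma dot_gt0 x : x != 0 -> 0 < dot x x.
Proof.
move=> x0; rewrite lt_neqAle dot_ge0 andbT eq_sym.
by apply: contra x0 => /eqP h; rewrite (dot_eq0 h).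
Qed.

Lemma bil_dot M x y : bil M x y = dot (x *m M) y. Proof. by []. Qed.
Lemma bilMD M N x y : bil (M + N) x y = bil M x y + bil N x y.
Proof. by rewrite !bil_dot mulmxDr dotDl. Qed.
Lemma bilMZ c M x y : bil (c *: M) x y = c * bil M x y.
Proof. by rewrite !bil_dot -scalemxAr dotZl. Qed.
Lemma bilMB M N x y : bil (M - N) x y = bil M x y - bil N x y.
Proof. by rewrite -scaleN1r bilMD bilMZ mulN1r. Qed.
Lemma bil0 x y : bil 0 x y = 0. Proof. by rewrite bil_dot mulmx0 dot0l. Qed.
Lemma bil_scalar c x y : bil c%:M x y = c * dot x y.
Proof. by rewrite bil_dot mul_mx_scalar dotZl. Qed.
Lemma mulmx_sqr x a : x *m sqr a = dot x a *: a.
Proof. by rewrite /sqr mulmxA [x *m a^T]mx11_scalar mul_scalar_mx. Qed.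
Lemma bil_sqr a x y : bil (sqr a) x y = dot x a * dot y a.
Proof. by rewrite bil_dot mulmx_sqr dotZl (dotC a). Qed.
Lemma bilDl M x y z : bil M (x + y) z = bil M x z + bil M y z.
Proof. by rewrite !bil_dot mulmxDl dotDl. Qed.
Lemma bilZl M c x y : bil M (c *: x) y = c * bil M x y.
Proof. by rewrite !bil_dot -scalemxAl dotZl. Qed.
Lemma bilC M x y : sym M -> bil M x y = bil M y x.
Proof. by move=> sM; rewrite !bil_dot dotC /dot trmx_mul sM mulmxA. Qed.
Lemma bilDr M x y z : sym M -> bil M x (y + z) = bil M x y + bil M x z.
Proof. by move=> sM; rewrite !(bilC x) // bilDl. Qed.
Lemma bilZr M c x y : sym M -> bil M x (c *: y) = c * bil M x y.
Proof. by move=> sM; rewrite !(bilC x) // bilZl. Qed.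

Lemma sym0 : sym 0. Proof. exact: trmx0. Qed.
Lemma symD M N : sym M -> sym N -> sym (M + N).
Proof. by rewrite /sym linearD /= => -> ->. Qed.
Lemma symZ c M : sym M -> sym (c *: M).
Proof. by rewrite /sym linearZ /= => ->. Qed.
Lemma symB M N : sym M -> sym N -> sym (M - N).
Proof. by rewrite /sym linearB /= => -> ->. Qed.
Lemma sym_sqr a : sym (sqr a). Proof. by rewrite /sym /sqr trmx_mul trmxK. Qed.
Lemma sym_scalar c : sym c%:M. Proof. exact: tr_scalar_mx. Qed.

Lemma psd0 : psd 0. Proof. by split=> [|x]; rewrite ?bil0 //; exact: sym0. Qed.
Lemma psdD M N : psd M -> psd N -> psd (M + N).
Proof.
by move=> [sM pM] [sN pN]; split=> [|x]; [exact: symD|rewrite bilMD addr_ge0].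
Qed.
Lemma psdZ c M : 0 <= c -> psd M -> psd (c *: M).
Proof.
by move=> c0 [sM pM]; split=> [|x]; [exact: symZ|rewrite bilMZ mulr_ge0].
Qed.
Lemma psd_sqr a : psd (sqr a).
Proof. by split=> [|x]; [exact: sym_sqr|rewrite bil_sqr -expr2 sqr_ge0]. Qed.
Lemma psd_scalar c : 0 <= c -> psd c%:M.
Proof.
by move=> c0; split=> [|x]; [exact: sym_scalar|rewrite bil_scalar mulr_ge0 ?dot_ge0].
Qed.

Lemma CauchySchwarz_psd M x y : psd M -> bil M x y ^+ 2 <= bil M x x * bil M y y.
Proof.
move=> [sM pM].
have pol t : 0 <= bil M x x - 2 * t * bil M x y + t ^+ 2 * bil M y y.
  have := pM (x + (- t) *: y).
  by rewrite bilDl !bilDr // !bilZl !bilZr // (bilC y x) //; lra.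
have [y0|yN0] := eqVneq (bil M y y) 0; last first.
  have y_gt0 : 0 < bil M y y by rewrite lt_neqAle eq_sym yN0 pM.
  have E : bil M x x * bil M y y - bil M x y ^+ 2 =
    (bil M x x - 2 * (bil M x y / bil M y y) * bil M x y
     + (bil M x y / bil M y y) ^+ 2 * bil M y y) * bil M y y by field.
  by rewrite -subr_ge0 E mulr_ge0 ?pM.
rewrite y0 mulr0 real_exprn_even_le0 ?num_real //=.
apply: contraT => xyN0.
(* When [bil M y y] vanishes the polynomial is affine in t, and this t gives it the value -1. *)
have := pol ((bil M x x + 1) / (2 * bil M x y)).
rewrite y0 mulr0 addr0.
have -> : 2 * ((bil M x x + 1) / (2 * bil M x y)) * bil M x y = bil M x x + 1.
  by field.
lra.
Qed.

(** By symmetry, the row space of M is the orthogonal complement of its kernel; the transposed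
    columns of [cokermx M] lie in that kernel. *)
Lemma submx_of_ker M a : sym M -> (forall x, x *m M = 0 -> dot x a = 0) ->
  (a <= M)%MS.
Proof.
move=> sM h; rewrite submxE; apply/eqP/rowP => j.
have xM : (col j (cokermx M))^T *m M = 0.
  by rewrite -[X in _ *m X]sM -trmx_mul colE mulmxA mulmx_coker mul0mx trmx0.
by have := h _ xM; rewrite dotC /dot trmxK colE mulmxA -colE !mxE.
Qed.

(** Evaluated at a kernel vector x of M, the second form is - c (x . a)^2, so x is orthogonal to
    a. *)
Lemma submx_psd c M a : 0 < c -> psd M -> psd (M - c *: sqr a) -> (a <= M)%MS.
Proof.
move=> c0 [sM pM] [_ pMa]; apply: submx_of_ker => // x xM.
have := pMa x; rewrite bilMB bilMZ bil_sqr bil_dot xM dot0l sub0r oppr_ge0 -expr2.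
rewrite pmulr_rle0 // real_exprn_even_le0 ?num_real //=.
by move/eqP.
Qed.

Lemma submx_psd1 M a : psd M -> psd (M - sqr a) -> (a <= M)%MS.
Proof. by move=> pM pMa; apply: (@submx_psd 1) => //; rewrite ?scale1r // ltr01. Qed.

End Bilinear.

Ltac mxring := repeat match goal with |- context [sqr ?a] => move: (sqr a) => ? end;
  apply/matrixP => ? ?; rewrite !mxE; ring.

Section Leverage.
Context {F : realFieldType} {d : nat}.
Implicit Types (M N X Y : 'M[F]_d) (x y z a b w : 'rV[F]_d) (c : F).

(** [pinvmx] is only some generalized inverse; for symmetric X and a in its row space the value does
    not depend on that choice, and [quad_pinv] identifies it with the Moore-Penrose value. *)
Definition lev X a : F := bil (pinvmx X) a a.

Lemma dot_solution X a b y z : sym X -> y *m X = a -> z *m X = b ->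
  dot y b = dot z a.
Proof. by move=> sX <- <-; rewrite dotC -bil_dot bilC // bil_dot dotC. Qed.

(** By symmetry of X, all preimages of a pair equally with a, so a leverage can be computed from any
    solution of y X = a. *)
Lemma levE X a y : sym X -> y *m X = a -> lev X a = dot y a.
Proof.
move=> sX yX; rewrite /lev bil_dot.
by apply: (dot_solution sX) => //; rewrite mulmxKpV // -yX submxMl.
Qed.

Lemma lev_ge0 X a : psd X -> (a <= X)%MS -> 0 <= lev X a.
Proof.
move=> [sX pX] /submxP[y ->]; rewrite (levE sX (erefl _)) dotC -bil_dot.
exact: pX.
Qed.

Lemma lev_psd_sqr_ge0 Y a : psd Y -> 0 <= lev (Y + sqr a) a.
Proof.
move=> pY; have pYa : psd (Y + sqr a) by apply: psdD => //; exact: psd_sqr.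
by apply: lev_ge0 => //; apply: submx_psd1 => //; rewrite addrK.
Qed.

(** Writing a = y X turns this into Cauchy-Schwarz for the form X at x and y. *)
Lemma CauchySchwarz_lev X a x : psd X -> (a <= X)%MS ->
  dot x a ^+ 2 <= lev X a * bil X x x.
Proof.
move=> pX /submxP[y yX]; have [sX _] := pX.
rewrite (levE sX (esym yX)) [in leRHS]dotC {2}yX -bil_dot dotC yX -bil_dot.
exact: CauchySchwarz_psd.
Qed.

Lemma psd_lev X a c : psd X -> (a <= X)%MS -> lev X a <= c ->
  psd (c *: X - sqr a).
Proof.
move=> pX aX lc; have [sX qX] := pX.
split=> [|x]; first by apply: symB; [exact: symZ|exact: sym_sqr].
rewrite bilMB bilMZ bil_sqr -expr2 subr_ge0.
apply: le_trans (CauchySchwarz_lev x pX aX) _.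
exact: ler_wpM2r.
Qed.

Lemma lev_eq0 X a : psd X -> (a <= X)%MS -> lev X a = 0 -> a = 0.
Proof.
move=> pX aX l0; apply: dot_eq0; have := CauchySchwarz_lev a pX aX.
by rewrite l0 mul0r real_exprn_even_le0 ?num_real //= => /eqP.
Qed.

(** Solve y Y = a and apply Cauchy-Schwarz in X at y: (lev Y a)^2 <= lev X a * bil X y y <= lev X a
    * lev Y a; then cancel. *)
Lemma lev_anti X Y a : psd X -> psd Y -> psd (Y - X) ->
  (a <= X)%MS -> (a <= Y)%MS -> lev Y a <= lev X a.
Proof.
move=> pX pY [_ XY] aX aY; have [sY _] := pY; case/submxP: (aY) => y yY.
have lY := levE sY (esym yY).
have bY : bil Y y y = lev Y a by rewrite lY bil_dot -yY dotC.
have := CauchySchwarz_lev y pX aX; rewrite -lY => h.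
have := XY y; rewrite bilMB bY subr_ge0 => h2.
have l0 := lev_ge0 pY aY; have [->|l1] := eqVneq (lev Y a) 0.
  exact: lev_ge0.
have lp : 0 < lev Y a by rewrite lt_neqAle eq_sym l1.
rewrite -(ler_pM2r lp) -expr2; apply: le_trans h _.
by apply: ler_wpM2l => //; exact: lev_ge0.
Qed.

Lemma lev_scale c X a : c != 0 -> sym X -> (a <= X)%MS ->
  lev (c *: X) a = c^-1 * lev X a.
Proof.
move=> c0 sX /submxP[y yX].
rewrite (levE sX (esym yX)) (@levE _ _ (c^-1 *: y)) ?dotZl //; first exact: symZ.
by rewrite -scalemxAl -scalemxAr scalerA mulVf // scale1r.
Qed.

(** If y X = w and z X = a, then y - t z solves the updated system for the t chosen below. X may be
    singular. *)
Lemma ShermanMorrison c X a w : sym X -> (a <= X)%MS -> (w <= X)%MS ->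
  1 + c * lev X a != 0 ->
  lev (X + c *: sqr a) w =
    lev X w - c / (1 + c * lev X a) * dot (w *m pinvmx X) a ^+ 2.
Proof.
move=> sX /submxP[z zX] wX; have := mulmxKpV wX.
set y := w *m pinvmx X => /esym yX h0.
have la := levE sX (esym zX); have lw := levE sX (esym yX).
have zw := dot_solution sX (esym zX) (esym yX).
set u := lev X a in h0 la *.
set k := dot y a in zw *.
set t := c * k / (1 + c * u).
rewrite (@levE _ _ (y - t *: z)); last 2 first.
- by apply: symD => //; apply: symZ; exact: sym_sqr.
- rewrite mulmxDr -scalemxAr mulmx_sqr mulmxBl -yX -scalemxAl -zX dotBl dotZl -la -/k.
  rewrite scalerA -addrA -scaleNr -scalerDl -[RHS]addr0; congr (_ + _).
  apply/eqP; rewrite scaler_eq0; apply/orP; left; apply/eqP.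
  by rewrite /t; field.
by rewrite dotBl dotZl -lw zw /t; congr (_ - _); field.
Qed.
End Leverage.

(** * One step of the sampling *)

Section OneStep.
Context {F : realFieldType} {d : nat}.
Variable h : F.
Hypothesis h_bounds : 0 < h < 1 / 2.
Implicit Types (M N X Y H W : 'M[F]_d) (x y z a b w : 'rV[F]_d) (p u q : F).

(** The last sum is the mean Sherman-Morrison coefficient over the coin: the upper gap gains 1 + 2h,
    less 1/p on keeping, and is compared with a gain of h. Its numerator is the slack in the
    hypothesis plus nonnegative terms. *)
Lemma upper_gain p u : 0 < p < 1 -> 0 <= u ->
    (1 + h) * u <= h * p * (1 + (1 - h) * u) ->
  [/\ 0 < 1 + (1 + h) * u, 0 < 1 + (1 + h - p^-1) * u &
  0 <= (1 - p) * ((1 + h) / (1 + (1 + h) * u))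
       + p * ((1 + h - p^-1) / (1 + (1 + h - p^-1) * u))].
Proof.
case/andP: h_bounds => h0 h1 /andP[p0 p1] u0 hu.
have pu0 : 0 <= p * u by apply: mulr_ge0 => //; exact: ltW.
have hpu0 : 0 <= h * (p * u) by apply: mulr_ge0 => //; exact: ltW.
have h2pu0 : 0 <= h * (h * (p * u)) by apply: mulr_ge0 => //; exact: ltW.
have d1 : 0 < 1 + (1 + h) * u by have := mulr_ge0 (ltW h0) u0; lra.
have d2' : 0 < p * (1 + (1 + h) * u) - u.
  rewrite -(@pmulr_rgt0 _ (1 + h)); last by lra.
  have E : (1 + h) * (p * (1 + (1 + h) * u) - u) =
     (h * p * (1 + (1 - h) * u) - (1 + h) * u)
     + (p + p * u + h * (p * u) + 2 * (h * (h * (p * u)))) by ring.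
  by rewrite E; lra.
have E2 : 1 + (1 + h - p^-1) * u = p^-1 * (p * (1 + (1 + h) * u) - u).
  by field; lra.
have d2 : 0 < 1 + (1 + h - p^-1) * u.
  by rewrite E2; apply: mulr_gt0 => //; rewrite invr_gt0.
split=> //.
have -> : (1 - p) * ((1 + h) / (1 + (1 + h) * u))
       + p * ((1 + h - p^-1) / (1 + (1 + h - p^-1) * u)) =
  (h * p * (1 + (1 + h) * u) - (1 + h) * u * (1 - p)) /
  ((1 + (1 + h) * u) * (p * (1 + (1 + h) * u) - u)).
  rewrite E2; field.
  by rewrite !gt_eqF //; lra.
apply: divr_ge0; last by apply: ltW; exact: mulr_gt0.
have E : h * p * (1 + (1 + h) * u) - (1 + h) * u * (1 - p) =
  (h * p * (1 + (1 - h) * u) - (1 + h) * u)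
  + (p * u + h * (p * u) + 2 * (h * (h * (p * u)))) by ring.
by rewrite E; lra.
Qed.

(** Counterpart for the lower gap, which gains 1/p - (1 - 2h) on keeping and loses 1 - 2h on
    skipping. *)
Lemma lower_gain p u : 0 < p < 1 -> 0 <= u ->
    (3 / 2 - h) * u <= h * p * (1 + (1 - h) * u) ->
  [/\ 0 < 1 + (- (1 - h)) * u, 0 < 1 + (p^-1 - (1 - h)) * u &
  0 <= (1 - p) * ((- (1 - h)) / (1 + (- (1 - h)) * u))
       + p * ((p^-1 - (1 - h)) / (1 + (p^-1 - (1 - h)) * u))].
Proof.
case/andP: h_bounds => h0 h1 /andP[p0 p1] u0 hu.
have pu0 : 0 <= p * u by apply: mulr_ge0 => //; exact: ltW.
have qu0 : 0 <= (1 - p) * u by apply: mulr_ge0 => //; lra.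
have ku0 : 0 <= (1 / 2 - h) * u by apply: mulr_ge0 => //; lra.
have hp : h * p < 1 / 2.
  by apply: le_lt_trans h1; rewrite -[leRHS]mulr1; apply: ler_wpM2l; exact: ltW.
have hkq0 : 0 <= h * ((1 - h) * ((1 - p) * u)).
  by apply: mulr_ge0; [exact: ltW|apply: mulr_ge0 => //; lra].
(* Since h p < 1/2, the hypothesis keeps u small enough for the denominator of the skip branch to
   stay positive. *)
have d1 : 0 < 1 + (- (1 - h)) * u.
  have : h * p * (1 + (1 - h) * u) =
    h * p + h * ((1 - h) * u) - h * ((1 - h) * ((1 - p) * u)) by ring.
  move=> E; rewrite E in hu.
  have : h * ((1 - h) * u) = h * u / 2 + h * ((1 / 2 - h) * u) by field.
  have : h * ((1 / 2 - h) * u) = (1/2 - h) * u / 2 - (1/2-h) * (1/2-h) * u by field.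
  have : 0 <= (1/2-h) * (1/2-h) * u by apply: mulr_ge0 => //; apply: mulr_ge0; lra.
  lra.
have d2 : 0 < 1 + (p^-1 - (1 - h)) * u.
  have : 0 <= p^-1 * u by apply: mulr_ge0 => //; rewrite invr_ge0 ltW.
  lra.
have d2' : 0 < p * (1 - (1 - h) * u) + u.
  have : 0 < p * (1 + (- (1 - h)) * u) by exact: mulr_gt0.
  lra.
have E2 : 1 + (p^-1 - (1 - h)) * u = p^-1 * (p * (1 - (1 - h) * u) + u).
  by field; lra.
split=> //.
have -> : (1 - p) * ((- (1 - h)) / (1 + (- (1 - h)) * u))
       + p * ((p^-1 - (1 - h)) / (1 + (p^-1 - (1 - h)) * u)) =
  (h * p * (1 - (1 - h) * u) - (1 - h) * u * (1 - p)) /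
  ((1 + (- (1 - h)) * u) * (p * (1 - (1 - h) * u) + u)).
  rewrite E2; field.
  by rewrite !gt_eqF //; lra.
apply: divr_ge0; last by apply: ltW; exact: mulr_gt0.
have E : h * p * (1 - (1 - h) * u) - (1 - h) * u * (1 - p) =
  (h * p * (1 + (1 - h) * u) - (3 / 2 - h) * u)
  + (u / 2 + (1 - h) * (2 * (1/2 - h)) * (p * u)) by field.
have : 0 <= (1 - h) * (2 * (1/2 - h)) * (p * u).
  by apply: mulr_ge0 => //; apply: mulr_ge0; lra.
by rewrite E; lra.
Qed.

(* Comparing X + (1 - h) a a^T with Y + a a^T turns into the bound on 1/lev X a that the
   sampling probability provides. *)
Lemma lev_discount X Y a : psd X -> psd Y -> psd (X - Y - h *: sqr a) ->
  lev X a <= lev (Y + sqr a) a * (1 + (1 - h) * lev X a).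
Proof.
case/andP: h_bounds => h0 h1 pX pY pXY; have [sX _] := pX.
have aX : (a <= X)%MS.
  apply: (@submx_psd _ _ h) => //.
  have -> : X - h *: sqr a = (X - Y - h *: sqr a) + Y.
    by mxring.
  exact: psdD.
have u0 := lev_ge0 pX aX.
have d0 : 0 < 1 + (1 - h) * lev X a.
  by have : 0 <= (1 - h) * lev X a; [apply: mulr_ge0 => //; lra|lra].
have pYa : psd (Y + sqr a) by apply: psdD => //; exact: psd_sqr.
have aYa : (a <= (Y + sqr a)%R)%MS.
  by apply: submx_psd1 => //; rewrite addrK.
have pZ : psd (X + (1 - h) *: sqr a).
  by apply: psdD => //; apply: psdZ; [lra|exact: psd_sqr].
have aZ : (a <= (X + (1 - h) *: sqr a)%R)%MS.
  apply: (@submx_psd _ _ (1 - h)) => //; first by lra.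
  by rewrite addrK.
have pZY : psd (X + (1 - h) *: sqr a - (Y + sqr a)).
  suff -> : X + (1 - h) *: sqr a - (Y + sqr a) = X - Y - h *: sqr a by [].
  by mxring.
have := lev_anti pYa pZ pZY aYa aZ; case/submxP: (aX) => z zX.
have la := levE sX (esym zX); set u := lev X a in u0 d0 la *.
have -> : lev (X + (1 - h) *: sqr a) a = u / (1 + (1 - h) * u).
  rewrite (@levE _ _ _ _ ((1 + (1 - h) * u)^-1 *: z)).
  - by rewrite dotZl -la mulrC.
  - by case: pZ.
  - rewrite -scalemxAl mulmxDr -scalemxAr mulmx_sqr -zX -la.
    have -> : a + (1 - h) *: (u *: a) = (1 + (1 - h) * u) *: a.
      by rewrite scalerA scalerDl scale1r.
    by rewrite scalerA mulVf ?scale1r // gt_eqF.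
by rewrite ler_pdivrMr.
Qed.

(** Common core for both gaps: keeping adds c1 a a^T, skipping adds c2 a a^T, and k is h times the
    sampling constant. [ShermanMorrison] in the two branches turns the mean decrease into the sum of
    the last hypothesis times a square. *)
Lemma lev_step k c1 c2 Y W a w p : psd Y -> psd W -> psd (W - sqr w) ->
    0 <= p <= 1 -> 0 < k ->
    (p < 1 -> k * lev (Y + sqr a) a <= h * p) ->
    (p = 1 -> h <= c1) ->
    (forall u, 0 < p < 1 -> 0 <= u -> k * u <= h * p * (1 + (1 - h) * u) ->
      [/\ 0 < 1 + (c2 - h) * u, 0 < 1 + (c1 - h) * u &
       0 <= (1 - p) * ((c2 - h) / (1 + (c2 - h) * u))
            + p * ((c1 - h) / (1 + (c1 - h) * u))]) ->
  p * lev (Y + c1 *: sqr a + W) w + (1 - p) * lev (Y + c2 *: sqr a + W) w <=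
  lev (Y + h *: sqr a + W) w.
Proof.
case/andP: h_bounds => h0 h1 pY pW pWw /andP[p0 p1] k0 qp c1h gain.
set X := Y + h *: sqr a + W.
have pX : psd X.
  by apply: psdD => //; apply: psdD => //; apply: psdZ; [exact: ltW|exact: psd_sqr].
have [sX _] := pX.
have XYh : psd (X - Y - h *: sqr a).
  by have -> : X - Y - h *: sqr a = W by rewrite /X; mxring.
have wX : (w <= X)%MS.
  apply: submx_psd1 => //; rewrite /X -addrA.
  by apply: psdD => //; apply: psdD => //; apply: psdZ; [exact: ltW|exact: psd_sqr].
have aX : (a <= X)%MS.
  apply: (@submx_psd _ _ h) => //; rewrite /X addrAC addrK.
  exact: psdD.
have u0 := lev_ge0 pX aX; have hle := lev_discount pX pY XYh.
have XE c : Y + c *: sqr a + W = X + (c - h) *: sqr a.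
  by rewrite /X; mxring.
(* At p = 1 only the keep branch counts; it can only enlarge the matrix, so antitonicity
   suffices. *)
rewrite !XE; have [pE|pN1] := eqVneq p 1.
  have {}c1h : 0 <= c1 - h by rewrite subr_ge0 c1h.
  rewrite pE subrr mul0r addr0 mul1r.
  have pXa : psd (X + (c1 - h) *: sqr a).
    by apply: psdD => //; apply: psdZ => //; exact: psd_sqr.
  apply: lev_anti => //.
  - by rewrite addrAC subrr add0r; apply: psdZ => //; exact: psd_sqr.
  - apply: submx_psd1 => //.
    have -> : X + (c1 - h) *: sqr a - sqr w =
      (W - sqr w) + (Y + (h + (c1 - h)) *: sqr a) by rewrite /X; mxring.
    apply: psdD => //; apply: psdD => //.
    by apply: psdZ; [lra|exact: psd_sqr].
have {pN1}p1' : p < 1 by rewrite lt_neqAle pN1.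
have {}qp := qp p1'.
have pYa : psd (Y + sqr a) by apply: psdD => //; exact: psd_sqr.
have aYa : (a <= (Y + sqr a)%R)%MS.
  by apply: submx_psd1 => //; rewrite addrK.
have q0 := lev_ge0 pYa aYa; set q := lev (Y + sqr a) a in q0 qp hle.
(* Probability 0 forces leverage 0, hence a = 0 and an unchanged matrix. *)
have [pE|pN0] := eqVneq p 0.
  have qE : q = 0.
    apply/eqP; rewrite eq_le q0 andbT -(@pmulr_rle0 _ k) //.
    by rewrite pE mulr0 in qp.
  have -> : a = 0 by exact: lev_eq0 qE.
  by rewrite /sqr mulmx0 !scaler0 addr0 pE mul0r add0r subr0 mul1r.
have {pN0}p0' : 0 < p by rewrite lt_neqAle eq_sym pN0.
set u := lev X a in u0 hle.
(* [lev_discount] converts the bound on q given by p into the bound on u that the gain hypothesis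
   expects. *)
have hu : k * u <= h * p * (1 + (1 - h) * u).
  have h2 : k * u <= k * (q * (1 + (1 - h) * u)) by apply: ler_wpM2l => //; exact: ltW.
  apply: le_trans h2 _; rewrite mulrA; apply: ler_wpM2r => //.
  by have : 0 <= (1 - h) * u; [apply: mulr_ge0 => //; lra|lra].
have [|d1 d2 {}gain] := gain u _ u0 hu; first by rewrite p0'.
rewrite !ShermanMorrison ?gt_eqF // -subr_ge0 -/u; set t := dot _ a.
set g2 := _ / _ in gain *; set g1 := (c1 - _) / _ in gain *.
have -> : lev X w - (p * (lev X w - g1 * t ^+ 2) + (1 - p) * (lev X w - g2 * t ^+ 2)) =
   ((1 - p) * g2 + p * g1) * t ^+ 2 by ring.
by rewrite mulr_ge0 ?sqr_ge0.
Qed.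

Lemma lev_step_upper Y W a w p : psd Y -> psd W -> psd (W - sqr w) ->
    0 <= p <= 1 ->
    (p < 1 -> (h^-1 + 1) * lev (Y + sqr a) a <= p) ->
  p * lev (Y + (1 + 2 * h - p^-1) *: sqr a + W) w +
    (1 - p) * lev (Y + (1 + 2 * h) *: sqr a + W) w <=
  lev (Y + h *: sqr a + W) w.
Proof.
case/andP: (h_bounds) => h0 h1 pY pW pWw p01 qp.
apply: (@lev_step (1 + h)) => //; first by lra.
- move=> p1; have -> : (1 + h) * lev (Y + sqr a) a = h * ((h^-1 + 1) * lev (Y + sqr a) a).
    by field; lra.
  by rewrite ler_pM2l // qp.
- by move=> ->; rewrite invr1; lra.
- move=> u p01' u0 hu.
  have -> : 1 + 2 * h - h = 1 + h by ring.
  have -> : 1 + 2 * h - p^-1 - h = 1 + h - p^-1 by ring.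
  exact: upper_gain.
Qed.

Lemma lev_step_lower Y W a w p : psd Y -> psd W -> psd (W - sqr w) ->
    0 <= p <= 1 ->
    (p < 1 -> (3 / 2 * h^-1 - 1) * lev (Y + sqr a) a <= p) ->
  p * lev (Y + (p^-1 - (1 - 2 * h)) *: sqr a + W) w +
    (1 - p) * lev (Y + (- (1 - 2 * h)) *: sqr a + W) w <=
  lev (Y + h *: sqr a + W) w.
Proof.
case/andP: (h_bounds) => h0 h1 pY pW pWw p01 qp.
apply: (@lev_step (3 / 2 - h)) => //; first by lra.
- move=> p1; have -> : (3 / 2 - h) * lev (Y + sqr a) a =
      h * ((3 / 2 * h^-1 - 1) * lev (Y + sqr a) a).
    by field; lra.
  by rewrite ler_pM2l // qp.
- by move=> ->; rewrite invr1; lra.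
- move=> u p01' u0 hu.
  have -> : - (1 - 2 * h) - h = - (1 - h) by ring.
  have -> : p^-1 - (1 - 2 * h) - h = p^-1 - (1 - h) by ring.
  exact: lower_gain.
Qed.
End OneStep.

(** * Potential function and its supermartingale property *)

Section Potential.
Context {F : realFieldType} {d : nat}.
Variable h : F.
Hypothesis h_bounds : 0 < h < 1 / 2.
Implicit Types (Y H : 'M[F]_d) (a : 'rV[F]_d) (p : F).

(** For p < 1, p dominates the leverage of a, so a a^T / p is at most Y + a a^T by [psd_lev], with
    2h a a^T to spare. *)
Lemma psd_keep_upper Y a p : psd Y -> 0 < p <= 1 ->
    (p < 1 -> (h^-1 + 1) * lev (Y + sqr a) a <= p) ->
  psd (Y + (1 + 2 * h - p^-1) *: sqr a).
Proof.
case/andP: h_bounds => h0 h1 pY /andP[p0 p1] qp.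
have pYa : psd (Y + sqr a) by apply: psdD => //; exact: psd_sqr.
have aYa : (a <= (Y + sqr a)%R)%MS by apply: submx_psd1 => //; rewrite addrK.
have q0 := lev_ge0 pYa aYa.
have [->|pN1] := eqVneq p 1.
  by rewrite invr1; apply: psdD => //; apply: psdZ; [lra|exact: psd_sqr].
have -> : Y + (1 + 2 * h - p^-1) *: sqr a =
    p^-1 *: (p *: (Y + sqr a) - sqr a) + (2 * h) *: sqr a.
  by rewrite scalerBr scalerA mulVf ?gt_eqF // scale1r; mxring.
apply: psdD; last by apply: psdZ; [lra|exact: psd_sqr].
apply: psdZ; first by rewrite invr_ge0 ltW.
apply: psd_lev => //; apply: le_trans (qp _); last by rewrite lt_neqAle pN1.
by rewrite mulrDl mul1r lerDr; apply: mulr_ge0 => //; rewrite invr_ge0 ltW.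
Qed.

Lemma psd_skip_lower Y a p : psd Y -> p < 1 ->
    (3 / 2 * h^-1 - 1) * lev (Y + sqr a) a <= p ->
  psd (Y + (- (1 - 2 * h)) *: sqr a).
Proof.
case/andP: h_bounds => h0 h1 pY p1 qp.
have pYa : psd (Y + sqr a) by apply: psdD => //; exact: psd_sqr.
have aYa : (a <= (Y + sqr a)%R)%MS by apply: submx_psd1 => //; rewrite addrK.
have q0 := lev_ge0 pYa aYa.
have -> : Y + (- (1 - 2 * h)) *: sqr a =
    (2 - 2 * h) *: ((2 - 2 * h)^-1 *: (Y + sqr a) - sqr a).
  by rewrite scalerBr scalerA mulfV ?scale1r ?gt_eqF //; [mxring|lra].
apply: psdZ; first by lra.
apply: psd_lev => //; set q := lev _ _ in q0 qp *.
have hq : (3 / 2 - h) * q <= h.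
  have -> : (3 / 2 - h) * q = h * ((3 / 2 * h^-1 - 1) * q) by field; lra.
  by rewrite -[leRHS]mulr1 ler_pM2l //; lra.
rewrite -[leRHS]mul1r ler_pdivlMr; last by lra.
have : (2 - 2 * h) * ((3 / 2 - h) * q) <= (2 - 2 * h) * h by apply: ler_wpM2l => //; lra.
(* After [hq], what remains is (2 - 2h) h <= 3/2 - h, a consequence of this square and h < 1/2. *)
have hk : 0 <= (1 / 2 - h) * (1 / 2 - h) by apply: mulr_ge0; lra.
move=> h2; rewrite -(@ler_pM2l _ (3 / 2 - h)); last by lra.
have : (3 / 2 - h) * (q * (2 - 2 * h)) = (2 - 2 * h) * ((3 / 2 - h) * q) by ring.
lra.
Qed.

(* The argument H carries h times the Gram matrix of the rows lying between the current
   one and the one whose sampling probability is being estimated. *)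
Fixpoint potential YU YL H (rs : seq 'rV[F]_d) : F :=
  if rs is a :: rs' then
    (h^-1 + 1) * lev (YU + (H + sqr a)) a
    + (3 / 2 * h^-1 - 1) * lev (YL + (H + sqr a)) a
    + potential YU YL (H + h *: sqr a) rs'
  else 0.

(** Each later row w contributes [lev_step_upper] and [lev_step_lower] with W = H + w w^T, and h w
    w^T then joins H for the rows after it. Reading a trades its share h a a^T for the random change
    of the gaps. *)
Lemma potential_supermartingale YU YL H a p rs :
    psd YU -> psd YL -> psd H -> 0 <= p <= 1 ->
    (p < 1 -> (h^-1 + 1) * lev (YU + sqr a) a
              + (3 / 2 * h^-1 - 1) * lev (YL + sqr a) a <= p) ->
  p * potential (YU + (1 + 2 * h - p^-1) *: sqr a)
                (YL + (p^-1 - (1 - 2 * h)) *: sqr a) H rs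
  + (1 - p) * potential (YU + (1 + 2 * h) *: sqr a)
                        (YL + (- (1 - 2 * h)) *: sqr a) H rs
  <= potential YU YL (H + h *: sqr a) rs.
Proof.
case/andP: (h_bounds) => h0 h1 pU pL pH p01 qp.
have cu0 : 0 < h^-1 + 1 by have : 0 < h^-1; [rewrite invr_gt0|lra].
have cl0 : 0 < 3 / 2 * h^-1 - 1.
  have : 1 <= h^-1 by rewrite invf_ge1 //; lra.
  lra.
have qU : p < 1 -> (h^-1 + 1) * lev (YU + sqr a) a <= p.
  by move=> /qp; apply: le_trans; rewrite lerDl mulr_ge0 ?lev_psd_sqr_ge0 // ltW.
have qL : p < 1 -> (3 / 2 * h^-1 - 1) * lev (YL + sqr a) a <= p.
  by move=> /qp; apply: le_trans; rewrite lerDr mulr_ge0 ?lev_psd_sqr_ge0 // ltW.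
elim: rs H pH => [|w rs IH] H pH /=; first by rewrite !mulr0 addr0.
have pW : psd (H + sqr w) by apply: psdD => //; exact: psd_sqr.
have pWw : psd (H + sqr w - sqr w) by rewrite addrK.
have sU := lev_step_upper h_bounds pU pW pWw p01 qU.
have sL := lev_step_lower h_bounds pL pW pWw p01 qL.
have EH : H + h *: sqr a + h *: sqr w = H + h *: sqr w + h *: sqr a by rewrite addrAC.
have EY Y : Y + (H + h *: sqr a + sqr w) = Y + h *: sqr a + (H + sqr w).
  by rewrite addrAC [in RHS]addrAC !addrA.
have := IH (H + h *: sqr w).
rewrite EH !EY => {}IH.
have {}IH := IH (psdD pH (psdZ (ltW h0) (psd_sqr w))).
rewrite -(ler_pM2l cu0) in sU; rewrite -(ler_pM2l cl0) in sL.
lra.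
Qed.
End Potential.

(** * The sampling algorithm *)

Section MoorePenrose.
Context {F : realFieldType}.

Lemma unitmx_gram m n (B : 'M[F]_(m, n)) : row_free B -> B *m B^T \in unitmx.
Proof.
move=> fB; rewrite -row_free_unit -kermx_eq0; apply/rowV0P => x /sub_kermxP xB.
have : dot (x *m B) (x *m B) = 0 by rewrite /dot trmx_mul !mulmxA -(mulmxA x) xB mul0mx mxE.
move/dot_eq0 => /eqP; rewrite (mulmx_free_eq0 _ fB).
by move/eqP.
Qed.
End MoorePenrose.

(** The classical formula for a full-rank factorization; the invertible Gram matrices cancel in all
    four Penrose identities. *)
Lemma is_MP_pinv_factor m r n (C : 'M[R]_(m, r)) (B : 'M[R]_(r, n)) :
    C^T *m C \in unitmx -> B *m B^T \in unitmx ->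
  is_MP_pinv (C *m B)
    (B^T *m invmx (B *m B^T) *m (invmx (C^T *m C) *m C^T)).
Proof.
move=> uC uB; set P := _ *m (_ *m _).
have MP : C *m B *m P = C *m invmx (C^T *m C) *m C^T.
  rewrite /P -!mulmxA; congr (C *m _).
  by rewrite (mulmxA B) (mulmxA (B *m B^T)) mulmxV // mul1mx.
have PM : P *m (C *m B) = B^T *m invmx (B *m B^T) *m B.
  rewrite /P -!mulmxA; congr (B^T *m (_ *m _)).
  by rewrite (mulmxA C^T) mulKmx.
have sC : (C^T *m C)^T = C^T *m C by rewrite trmx_mul trmxK.
have sB : (B *m B^T)^T = B *m B^T by rewrite trmx_mul trmxK.
split.
- by rewrite MP -!mulmxA; congr (C *m _); rewrite (mulmxA C^T) mulKmx.
- rewrite PM /P -!mulmxA; congr (B^T *m _).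
  by rewrite (mulmxA B) (mulmxA (invmx _)) mulVmx // mul1mx.
- by rewrite MP !trmx_mul trmxK trmx_inv sC mulmxA.
- by rewrite PM !trmx_mul trmxK trmx_inv sB mulmxA.
Qed.

(** [pinv] is chosen by [epsilon], so its equations become available through this witness, built
    from the rank factorization of M. *)
Lemma MP_pinv_exists m n (M : 'M[R]_(m, n)) : exists P, is_MP_pinv M P.
Proof.
rewrite -[M]mulmx_base; eexists; apply: is_MP_pinv_factor.
- rewrite -{2}[col_base M]trmxK; apply: unitmx_gram.
  by rewrite /row_free mxrank_tr; exact: col_base_full.
- by apply: unitmx_gram; exact: row_base_free.
Qed.

(** X X^+ X = X makes a X^+ a solution of y X = a, and [levE] accepts any solution. *)
Lemma quad_pinv d (X : 'M[R]_d) a : sym X -> (a <= X)%MS ->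
  quad a (pinv X) = lev X a.
Proof.
move=> sX /submxP[y yX].
have [XPX _ _ _] : is_MP_pinv X (pinv X) := ClassicalEpsilon.epsilon_spec _ _ (MP_pinv_exists X).
by symmetry; apply: levE => //; rewrite yX -!mulmxA (mulmxA X) XPX.
Qed.

Lemma Rle_ler (x y : R) : Rle x y <-> x <= y.
Proof. by split => [h|/RlebP //]; apply/RlebP. Qed.

Lemma RdivE (x y : R) : y != 0 -> Rdiv x y = x / y.
Proof.
move=> y0; rewrite /Rdiv; congr Rmult.
by rewrite /GRing.inv /= /Rinvx (negPf y0).
Qed.

(* [cU] and [cL] are elaborated in R_scope, with Stdlib's operations. *)
Lemma cUE (eps : R) : eps != 0 -> cU eps = 2 / eps + 1.
Proof. by move=> e0; rewrite /cU RdivE. Qed.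

Lemma cLE (eps : R) : eps != 0 -> cL eps = 3 / eps - 1.
Proof. by move=> e0; rewrite /cL RdivE. Qed.

(** * Invariant of the algorithm and expected sample size *)

Section Algorithm.
Context {d : nat}.
Variable eps : R.
Hypothesis eps_bounds : 0 < eps < 1.
Implicit Types (st : alg_state d) (a b : 'rV[R]_d) (s rs : seq 'rV[R]_d).

Lemma gramE s : gram s = \sum_(b <- s) sqr b.
Proof.
apply/matrixP => i j; rewrite /gram mxE summxE (big_nth 0) big_mkord.
apply: eq_bigr => k _.
by rewrite !mxE big_ord1 !mxE.
Qed.

Lemma gram_rcons s b : gram (rcons s b) = gram s + sqr b.
Proof. by rewrite !gramE -cats1 big_cat big_seq1. Qed.

Lemma gram_rows n (A : 'M[R]_(n, d)) :
  A^T *m A = \sum_(a <- rows_of A) sqr a.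
Proof.
rewrite /rows_of big_map big_enum /=.
apply/matrixP => i j; rewrite mxE summxE.
by apply: eq_bigr => k _; rewrite !mxE big_ord1 !mxE.
Qed.

Lemma sqrZ (c : R) a : sqr (c *: a) = (c ^+ 2) *: sqr a.
Proof. by apply/matrixP => i j; rewrite !mxE !big_ord1 !mxE; ring. Qed.

Lemma sqr_sqrt_inv (p : R) : 0 <= p -> ((sqrt p)^-1) ^+ 2 = p^-1.
Proof.
move=> /Rle_ler p0; rewrite exprVn expr2; congr (_^-1).
exact: sqrt_sqrt.
Qed.

Definition gapU st := st_BU st - gram (st_rows st).
Definition gapL st := gram (st_rows st) - st_BL st.
(** The loop invariant; at the end of the run it is the two-sided Loewner bound. *)
Definition good st := psd (gapU st) /\ psd (gapL st).
(** In terms of h, the sampling constants are c_U = 1/h + 1 and c_L = 3/(2h) - 1. *)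
Let h := eps / 2.

Let h_bounds : 0 < h < 1 / 2.
Proof. by rewrite /h; case/andP: eps_bounds => *; apply/andP; split; lra. Qed.

Lemma probE st a : good st ->
  prob eps st a = Num.min ((h^-1 + 1) * lev (gapU st + sqr a) a
     + (3 / 2 * h^-1 - 1) * lev (gapL st + sqr a) a) 1.
Proof.
move=> [pU pL].
have q (Y : 'M[R]_d) : psd Y -> quad a (pinv (Y + sqr a)) = lev (Y + sqr a) a.
  move=> pY; have pYa : psd (Y + sqr a) by apply: psdD => //; exact: psd_sqr.
  apply: quad_pinv; first by case: pYa.
  by apply: submx_psd1 => //; rewrite addrK.
have e0 : eps != 0 by rewrite gt_eqF //; case/andP: eps_bounds.
rewrite /prob /XU /XL -/(sqr a) -/(gapU st) -/(gapL st) !q //.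
congr (Num.min (_ * _ + _ * _) _); rewrite ?cUE ?cLE // /h; field; rewrite e0 //.
Qed.

Lemma coefU_ge0 : 0 <= h^-1 + 1.
Proof. by case/andP: h_bounds => h0 _; rewrite addr_ge0 // invr_ge0 ltW. Qed.

Lemma coefL_ge0 : 0 <= 3 / 2 * h^-1 - 1.
Proof.
case/andP: h_bounds => h0 h1; have : 1 <= h^-1 by rewrite invf_ge1 //; lra.
lra.
Qed.

Lemma prob_ge0 st a : good st -> 0 <= prob eps st a.
Proof.
move=> g; have [pU pL] := g; rewrite probE // le_min ler01 andbT.
by rewrite addr_ge0 // mulr_ge0 ?coefU_ge0 ?coefL_ge0 ?lev_psd_sqr_ge0.
Qed.

Lemma prob_le1 st a : prob eps st a <= 1.
Proof. by rewrite /prob ge_min lexx orbT. Qed.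

Lemma prob_lt1 st a : good st -> prob eps st a < 1 ->
  (h^-1 + 1) * lev (gapU st + sqr a) a
     + (3 / 2 * h^-1 - 1) * lev (gapL st + sqr a) a <= prob eps st a.
Proof.
by move=> g; rewrite probE // gt_min ltxx orbF => l1; rewrite le_min lexx ltW.
Qed.

Lemma gapU_keep st a : good st ->
  gapU (keep eps st a) = gapU st + (1 + 2 * h - (prob eps st a)^-1) *: sqr a.
Proof.
move=> g; rewrite /gapU /= gram_rcons sqrZ sqr_sqrt_inv ?prob_ge0 // -/(sqr a).
have -> : 2 * h = eps by rewrite /h; field.
by mxring.
Qed.

Lemma gapL_keep st a : good st ->
  gapL (keep eps st a) = gapL st + ((prob eps st a)^-1 - (1 - 2 * h)) *: sqr a.
Proof.
move=> g; rewrite /gapL /= gram_rcons sqrZ sqr_sqrt_inv ?prob_ge0 // -/(sqr a).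
have -> : 2 * h = eps by rewrite /h; field.
by mxring.
Qed.

Lemma gapU_skip st a : gapU (skip eps st a) = gapU st + (1 + 2 * h) *: sqr a.
Proof.
rewrite /gapU /= -/(sqr a); have -> : 2 * h = eps by rewrite /h; field.
by mxring.
Qed.

Lemma gapL_skip st a : gapL (skip eps st a) = gapL st + (- (1 - 2 * h)) *: sqr a.
Proof.
rewrite /gapL /= -/(sqr a); have -> : 2 * h = eps by rewrite /h; field.
by mxring.
Qed.

(** The lower gap grows because 1/p >= 1, so only the upper gap is at risk; skipping reverses the
    roles. *)
Lemma good_keep st a : good st -> 0 < prob eps st a -> good (keep eps st a).
Proof.
move=> g p0; have [pU pL] := g; case/andP: (h_bounds) => h0 h1.
have p1 := prob_le1 st a; split.
  rewrite gapU_keep //; apply: psd_keep_upper => //; first by rewrite p0.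
  move=> /(prob_lt1 g); apply: le_trans; rewrite lerDl.
  by rewrite mulr_ge0 ?coefL_ge0 ?lev_psd_sqr_ge0.
rewrite gapL_keep //; apply: psdD => //; apply: psdZ; last exact: psd_sqr.
have : 1 <= (prob eps st a)^-1 by rewrite invf_ge1.
lra.
Qed.

Lemma good_skip st a : good st -> 0 < 1 - prob eps st a -> good (skip eps st a).
Proof.
rewrite subr_gt0 => g p1; have [pU pL] := g; case/andP: (h_bounds) => h0 h1; split.
  by rewrite gapU_skip; apply: psdD => //; apply: psdZ; [lra|exact: psd_sqr].
rewrite gapL_skip; apply: (psd_skip_lower h_bounds _ p1) => //.
apply: le_trans (prob_lt1 g p1); rewrite lerDr.
by rewrite mulr_ge0 ?coefU_ge0 ?lev_psd_sqr_ge0.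
Qed.

(** G is the Gram matrix of the rows already read. It determines both barriers, so the final
    invariant becomes the two inequalities handed to P. *)
Lemma almost_surely_gram st rs (G : 'M[R]_d) (P : seq 'rV[R]_d -> Prop) :
    good st -> st_BU st = (1 + eps) *: G -> st_BL st = (1 - eps) *: G ->
    (forall s, let G' := G + \sum_(a <- rs) sqr a in
       psd ((1 + eps) *: G' - gram s) -> psd (gram s - (1 - eps) *: G') -> P s) ->
  almost_surely P eps st rs.
Proof.
elim: rs st G => [|a rs IH] st G g BU BL hP.
  by case: g => gU gL; apply: hP; rewrite big_nil addr0 -?BU -?BL.
have hP' s : let G' := G + sqr a + \sum_(b <- rs) sqr b in
    psd ((1 + eps) *: G' - gram s) -> psd (gram s - (1 - eps) *: G') -> P s.
  by have := hP s; rewrite big_cons addrA.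
have step st' : good st' -> st_BU st' = st_BU st + (1 + eps) *: sqr a ->
    st_BL st' = st_BL st + (1 - eps) *: sqr a -> almost_surely P eps st' rs.
  by move=> g' eU eL; apply: (IH _ (G + sqr a)) => //; rewrite scalerDr ?eU ?eL ?BU ?BL.
split=> hp; apply: step => //; first exact: good_keep.
exact: good_skip.
Qed.

(** p is at most the two terms that the potential charges to a, and the mean of the remaining
    potential over the coin does not grow. *)
Lemma expected_rows_le_potential st rs : good st ->
  expected_rows eps st rs <=
    (size (st_rows st))%:R + potential h (gapU st) (gapL st) 0 rs.
Proof.
elim: rs st => [|a rs IH] st g; first by rewrite /= addr0.
have [pU pL] := g; set p := prob eps st a.
have -> : expected_rows eps st (a :: rs) =
  p * expected_rows eps (keep eps st a) rs +
  (1 - p) * expected_rows eps (skip eps st a) rs by [].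
rewrite [potential _ _ _ _ _]/=.
have p0 : 0 <= p by exact: prob_ge0.
have p1 : p <= 1 by exact: prob_le1.
have hk : p * expected_rows eps (keep eps st a) rs <=
    p * ((size (st_rows st))%:R + 1 +
     potential h (gapU st + (1 + 2 * h - p^-1) *: sqr a)
       (gapL st + (p^-1 - (1 - 2 * h)) *: sqr a) 0 rs).
  (* The induction hypothesis needs a good state, which [good_keep] supplies only for positive
     probability; a zero weight is settled apart. *)
  have [->|pN0] := eqVneq p 0; first by rewrite !mul0r.
  have p0' : 0 < p by rewrite lt_neqAle eq_sym pN0.
  rewrite ler_pM2l //; apply: le_trans (IH _ (good_keep g p0')) _.
  by rewrite gapU_keep // gapL_keep // size_rcons -natr1.
have hs : (1 - p) * expected_rows eps (skip eps st a) rs <=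
    (1 - p) * ((size (st_rows st))%:R +
     potential h (gapU st + (1 + 2 * h) *: sqr a)
       (gapL st + (- (1 - 2 * h)) *: sqr a) 0 rs).
  have [->|pN1] := eqVneq p 1; first by rewrite subrr !mul0r.
  have p1' : 0 < 1 - p by rewrite subr_gt0 lt_neqAle pN1.
  rewrite ler_pM2l //; apply: le_trans (IH _ (good_skip g p1')) _.
  by rewrite gapU_skip gapL_skip.
apply: le_trans (lerD hk hs) _.
have p01 : 0 <= p <= 1 by rewrite p0.
have := potential_supermartingale h_bounds rs pU pL psd0 p01 (prob_lt1 g).
have : p <= (h^-1 + 1) * lev (gapU st + sqr a) a
          + (3 / 2 * h^-1 - 1) * lev (gapL st + sqr a) a.
  by rewrite /p probE // ge_min lexx.
rewrite !add0r; lra.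
Qed.
End Algorithm.

(** * Spectral theory of real symmetric matrices *)

Lemma continuity_horner (p : {poly R}) : continuity (fun x => p.[x]).
Proof.
elim/poly_ind: p => [|p c IH].
  have -> : (fun x => (0 : {poly R}).[x]) = fct_cte (0 : R).
    by apply: FunctionalExtensionality.functional_extensionality => x; rewrite horner0.
  by apply: continuity_const.
have -> : (fun x => (p * 'X + c%:P).[x]) =
          plus_fct (mult_fct (fun x => p.[x]) id) (fct_cte c).
  by apply: FunctionalExtensionality.functional_extensionality => x; rewrite hornerMXaddC.
apply: continuity_plus; last exact: continuity_const.
by apply: continuity_mult => //; apply: derivable_continuous; exact: derivable_id.
Qed.

(** The intermediate value theorem for polynomials. It gives access to complex numbers over R, where
    Hermitian matrices are unitarily diagonalized. *)
Lemma R_real_closed : Num.real_closed_axiom R.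
Proof.
move=> p a b ab /andP[pa pb].
case: (IVT_cor (fun x => p.[x]) a b (continuity_horner p)).
- exact/Rle_ler.
- apply/Rle_ler; exact: mulr_le0_ge0.
move=> z [[/Rle_ler az /Rle_ler zb] pz].
by exists z; [rewrite az | apply/rootP].
Qed.
HB.instance Definition _ := Num.RealField_isClosed.Build R R_real_closed.

(** * Determinants of rank-one updates *)

Lemma det_addM_mulmx (F : comNzRingType) d (u : 'cV[F]_d) (v : 'rV[F]_d) :
  \det (1%:M + u *m v) = 1 + (v *m u) 0 0.
Proof.
(* Two block triangular factorizations of one matrix; equating their determinants gives the
   claim. *)
have E : block_mx 1%:M 0 (- u) 1%:M *m block_mx 1%:M v 0 (1%:M + u *m v) =
         block_mx (1%:M + v *m u) v 0 1%:M *m block_mx 1%:M 0 (- u) 1%:M.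
  rewrite !mulmx_block !mul1mx !mulmx1 !mulmx0 !mul0mx !mulmxN !mulNmx.
  by rewrite !addr0 !add0r addrK addrCA addNr addr0.
have := congr1 determinant E.
rewrite !det_mulmx !det_lblock !det_ublock !det1 !mul1r !mulr1 => ->.
by rewrite det_mx11 !mxE eqxx.
Qed.

Section Determinant.
Context {F : realFieldType} {d : nat}.
Implicit Types (X M : 'M[F]_d) (a : 'rV[F]_d).

Lemma det_rank1_update c X a : sym X -> X \in unitmx ->
  \det (X + c *: sqr a) = \det X * (1 + c * lev X a).
Proof.
move=> sX uX.
have -> : X + c *: sqr a = (1%:M + (c *: a^T) *m (a *m invmx X)) *m X.
  by rewrite mulmxDl mul1mx -mulmxA mulmxKV // -scalemxAl.
rewrite det_mulmx det_addM_mulmx mulrC; congr (_ * (1 + _)).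
rewrite (@levE _ _ _ _ (a *m invmx X)) ?mulmxKV //.
by rewrite -scalemxAr mxE.
Qed.

Lemma psd_unitmx c X : 0 < c -> psd (X - c%:M) -> X \in unitmx.
Proof.
move=> c0 [_ pX]; rewrite -row_free_unit -kermx_eq0; apply/rowV0P => x /sub_kermxP xX.
apply: dot_eq0; apply/eqP; rewrite eq_le dot_ge0 andbT.
have := pX x; rewrite bilMB bil_dot xX dot0l bil_scalar sub0r oppr_ge0.
by rewrite pmulr_rle0.
Qed.

Lemma det_gt0_update c X a : 0 < c -> psd (X - c%:M) -> 0 < \det X ->
  0 < \det (X + sqr a).
Proof.
move=> c0 pXc d0; have uX := psd_unitmx c0 pXc.
have pX : psd X.
  by rewrite -[X](subrK c%:M); apply: psdD => //; apply: psd_scalar; exact: ltW.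
have [sX _] := pX.
rewrite -[sqr a]scale1r det_rank1_update // mul1r mulr_gt0 //.
rewrite ltr_pwDl // lev_ge0 // submx_full //.
by rewrite row_full_unit.
Qed.
End Determinant.

(** * Spectral decomposition expressed with real data *)

Section Spectral.
Context {F : rcfType} {d : nat}.
Implicit Types (G : 'M[F]_d) (x : 'rV[F]_d).

(** Selecting the rows and columns of the nonzero entries leaves an invertible diagonal matrix, and
    such a compression cannot raise the rank. *)
Lemma rank_diag_ge (K : fieldType) (D : 'rV[K]_d) :
  (#|[pred i | D 0%R i != 0%R]| <= \rank (diag_mx D))%N.
Proof.
set S := [pred i | _]; pose f (k : 'I_#|S|) := enum_val k.
pose E := rowsub f (1%:M : 'M[K]_d).
have ED : E *m diag_mx D *m E^T = diag_mx (\row_k D 0 (f k)).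
  apply/matrixP => k l; rewrite !mxE (bigD1 (f l)) //= big1 ?addr0; last first.
    by move=> j jf; rewrite !mxE eq_sym (negPf jf) mulr0.
  rewrite !mxE eqxx mulr1 (bigD1 (f l)) //= big1 ?addr0; last first.
    by move=> j jf; rewrite !mxE (negPf jf) mulr0n mulr0.
  rewrite !mxE eqxx mulr1n (inj_eq enum_val_inj).
  by case: eqP => [->|_]; rewrite ?mul1r ?mulr1n ?mul0r ?mulr0n.
have uD : diag_mx (\row_k D 0 (f k)) \in unitmx.
  rewrite unitmxE det_diag unitfE; apply/prodf_neq0 => k _; rewrite mxE.
  by have := enum_valP k; rewrite inE.
have <- : \rank (diag_mx (\row_k D 0 (f k))) = #|S| by exact: mxrank_unit.
by rewrite -ED; apply: leq_trans (mxrankM_maxl _ _) (mxrankM_maxr _ _).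
Qed.

Local Notation C := (real_complex F).

(** D lists the eigenvalues with multiplicity, and w i is the squared modulus of the i-th coordinate
    of x in a complex unitary eigenbasis. Rayleigh quotients thus become weighted averages of the D
    i, with no complex number left in the statement. *)
Lemma symmetric_spectral G : sym G -> exists D : 'I_d -> F,
  [/\ forall i, eigenvalue G (D i),
      forall c, \det (c%:M + G) = \prod_i (c + D i),
      (#|[pred i | D i != 0%R]| <= \rank G)%N &
      forall x, exists w : 'I_d -> F,
        [/\ forall i, 0 <= w i, dot x x = \sum_i w i,
            bil G x x = \sum_i w i * D i &
            (x <= G)%MS -> forall i, D i = 0 -> w i = 0]].
Proof.
move=> sG; pose Gc := map_mx C G.
have realC (r : F) : C r \is Num.real by rewrite complex_real.
have realmxC m n (M : 'M[F]_(m, n)) : map_mx C M \is a mxOver Num.real.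
  by apply/mxOverP => i j; rewrite mxE.
have hG : Gc \is hermsymmx.
  apply: realsym_hermsym; last exact: realmxC.
  by apply/is_hermitianmxP/matrixP => i j; rewrite !mxE expr0 mul1r -{1}sG mxE.
have /hermitian_normalmx/orthomx_spectralP GE := hG.
have spR := hermitian_spectral_diag_real hG.
set P := spectralmx Gc in GE *; set sp := spectral_diag Gc in GE spR *.
have uP : P \in unitmx by exact: spectral_unit.
have iP : invmx P = (P^T ^ Num.conj)%sesqui by apply: invmx_unitary; exact: spectral_unitarymx.
pose D i := complex.Re (sp 0 i).
have spE i : sp 0 i = C (D i) by rewrite RRe_real //; exact: (mxOverP spR).
have PG : P *m Gc = diag_mx sp *m P by rewrite {1}GE !mulmxA mulmxV // mul1mx.
exists D; split.
- move=> i; rewrite -(eigenvalue_map C) -/Gc; apply/eigenvalueP.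
  exists (row i P).
    by rewrite -row_mul PG mul_diag_mx; apply/rowP => j; rewrite !mxE spE.
  apply/eqP => r0; have := row_mul i P (invmx P).
  rewrite r0 mul0mx mulmxV // => /rowP/(_ i).
  by rewrite !mxE eqxx => /eqP; rewrite oner_eq0.
- move=> c; apply: (@complexI F); rewrite -det_map_mx map_mxD map_scalar_mx -/Gc.
  have -> : (C c)%:M + Gc = invmx P *m ((C c)%:M + diag_mx sp) *m P.
    rewrite mulmxDr mulmxDl -GE; congr (_ + _).
    by rewrite mul_mx_scalar -scalemxAl mulVmx // scalemx1.
  rewrite !det_mulmx mulrAC -det_mulmx mulVmx // det1 mul1r.
  have -> : (C c)%:M + diag_mx sp = diag_mx (\row_i (C c + sp 0 i)).
    by apply/matrixP => i j; rewrite !mxE; case: eqP => [->|_]; rewrite ?mulr1n ?mulr0n ?addr0.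
  rewrite det_diag rmorph_prod; apply: eq_bigr => i _.
  by rewrite mxE spE rmorphD.
- have -> : \rank G = \rank (diag_mx sp).
    rewrite -(mxrank_map C) -/Gc GE mxrankMfree ?row_free_unit //.
    by rewrite -mxrank_tr trmx_mul mxrankMfree ?mxrank_tr // row_free_unit unitmx_tr unitmx_inv.
  apply: leq_trans (rank_diag_ge sp); rewrite leq_eqVlt; apply/orP; left.
  apply/eqP; apply: eq_card => i; rewrite !inE spE.
  by rewrite -(inj_eq (@complexI F)).
- move=> x; have [z zE] : exists z, z = map_mx C x *m invmx P by eexists.
  pose w i := complex.Re (z 0 i) ^+ 2 + complex.Im (z 0 i) ^+ 2.
  have wE i : C (w i) = z 0 i * (z 0 i)^* by rewrite add_Re2_Im2 normCK.
  have zc : (z^T ^ Num.conj)%sesqui = P *m (map_mx C x)^T.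
    rewrite zE iP trmx_mul map_mxM trmxCK; congr (_ *m _).
    by apply/matrixP => i j; rewrite !mxE; apply/CrealP.
  exists w; split.
  + by move=> i; rewrite addr_ge0 ?sqr_ge0.
  + apply: (@complexI F); rewrite rmorph_sum /=.
    have -> : C (dot x x) = (z *m (z^T ^ Num.conj)%sesqui) 0 0.
      rewrite zc zE -mulmxA mulKmx // /dot.
      by rewrite map_trmx -map_mxM [in RHS]mxE.
    by rewrite mxE; apply: eq_bigr => i _; rewrite !mxE -wE.
  + apply: (@complexI F); rewrite rmorph_sum /=.
    have -> : C (bil G x x) = (z *m diag_mx sp *m (z^T ^ Num.conj)%sesqui) 0 0.
      rewrite zc zE !mulmxA -(mulmxA _ (diag_mx sp)) -PG mulmxA mulmxKV //.
      by rewrite /Gc map_trmx -!map_mxM [in RHS]mxE.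
    rewrite mxE; apply: eq_bigr => i _.
    by rewrite mul_mx_diag !mxE spE mulrAC -wE rmorphM.
  (* Writing x = y G puts a factor D i into the i-th coordinate. *)
  + move=> /submxP[y yG] i Di0; apply: (@complexI F).
    rewrite wE; have -> : z 0 i = 0; last by rewrite mul0r.
    rewrite zE yG map_mxM -/Gc GE !mulmxA mulmxK //.
    by rewrite mul_mx_diag mxE spE Di0 rmorph0 mulr0.
Qed.
End Spectral.

(** * Sum of the regularized leverages *)

Section LogDet.
Context {d : nat}.
Implicit Types (M G : 'M[R]_d) (a x : 'rV[R]_d) (lam : R) (rs : seq 'rV[R]_d).

(* For positive semidefinite M: every nonzero eigenvalue is at least lam. *)
Definition spectral_gap lam M : Prop :=
  forall x, (x <= M)%MS -> lam * dot x x <= bil M x x.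

(** Take y in the row space of M with y M = a. The gap bounds lam (y . y) by lev M a, so y has
    energy at most 2 lev M a in lam I + M, and Cauchy-Schwarz there gives the factor 2. *)
Lemma lev_regularize lam M a : 0 < lam -> psd M -> (a <= M)%MS ->
  spectral_gap lam M -> lev M a <= 2 * lev (lam%:M + M) a.
Proof.
move=> lam0 pM aM gap; have [sM _] := pM.
have sMM : sym (M *m M) by rewrite /sym trmx_mul sM.
(* M and M M have the same kernel, hence the same row space; this places the preimage y = z M in the
   row space, where the gap applies. *)
have /submxP[z zMM] : (a <= M *m M)%MS.
  apply: submx_of_ker => // x xMM.
  have xM : x *m M = 0.
    apply: dot_eq0; rewrite -bil_dot bilC // bil_dot -mulmxA xMM.
    exact: dot0l.
  by case/submxP: aM => y ->; rewrite dotC -bil_dot bilC // bil_dot xM dot0l.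
set y := z *m M; have yM : y *m M = a by rewrite /y -mulmxA zMM.
have yle : (y <= M)%MS by exact: submxMl.
have lM : lev M a = dot y a by exact: levE.
have bM : bil M y y = lev M a by rewrite lM bil_dot yM dotC.
have pN : psd (lam%:M + M) by apply: psdD => //; apply: psd_scalar; exact: ltW.
have aN : (a <= (lam%:M + M)%R)%MS.
  rewrite submx_full // row_full_unit; apply: (psd_unitmx lam0).
  by rewrite addrAC subrr add0r.
have l0 : 0 <= lev M a by exact: lev_ge0.
have l1 : 0 <= lev (lam%:M + M) a by exact: lev_ge0.
have := CauchySchwarz_lev y pN aN.
rewrite bilMD bil_scalar bM -lM => h1; have h2 := gap y yle; rewrite bM in h2.
have [->|lN0] := eqVneq (lev M a) 0; first by rewrite mulr_ge0.
have lp : 0 < lev M a by rewrite lt_neqAle eq_sym lN0.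
rewrite -(ler_pM2r lp) -expr2; apply: le_trans h1 _.
rewrite -mulrA mulrCA; apply: ler_wpM2l => //; lra.
Qed.

Lemma ln_le_sub1 (x : R) : 0 < x -> ln x <= x - 1.
Proof.
move=> x0; have /Rle_ler := exp_ineq1_le (ln x).
rewrite exp_ln; last by apply/RltbP.
by move=> h; rewrite lerBrDl.
Qed.

Lemma ln_mul (x y : R) : 0 < x -> 0 < y -> ln (x * y)%R = ln x + ln y.
Proof. by move=> /RltbP x0 /RltbP y0; exact: ln_mult. Qed.

Lemma ln_homo (x y : R) : 0 < x -> x <= y -> ln x <= ln y.
Proof.
move=> x0; rewrite le_eqVlt => /orP[/eqP -> //|xy].
by apply/Rle_ler; left; apply: ln_increasing; apply/RltbP.
Qed.

(** Removing a a^T from X multiplies the determinant by 1 - lev X a, and ln (1 - t) <= - t. *)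
Lemma lev_le_ln_det lam M a : 0 < lam -> psd M ->
  0 < \det (lam%:M + M) ->
  lev (lam%:M + (M + sqr a)) a <=
    ln (\det (lam%:M + (M + sqr a))) - ln (\det (lam%:M + M)).
Proof.
move=> lam0 pM d0.
have gapM N : psd N -> psd (lam%:M + N - lam%:M) by rewrite addrAC subrr add0r.
have d1 : 0 < \det (lam%:M + (M + sqr a)).
  by rewrite addrA (det_gt0_update _ lam0) //; exact: gapM.
have pMa : psd (M + sqr a) by apply: psdD => //; exact: psd_sqr.
set X := lam%:M + (M + sqr a) in d1 *.
have uX : X \in unitmx by apply: (psd_unitmx lam0); exact: gapM.
have sX : sym X by apply: symD; [exact: sym_scalar|case: pMa].
have E : \det (lam%:M + M) = \det X * (1 + (-1) * lev X a).
  by rewrite -det_rank1_update // /X; congr (\det _); mxring.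
have r0 : 0 < 1 + (-1) * lev X a by move: d0; rewrite E pmulr_rgt0.
rewrite E ln_mul //; have := ln_le_sub1 r0; lra.
Qed.

(** With zero gaps the two leverages coincide and their coefficients add up to 5/(2h). Passing to h
    (G + a a^T) costs 1/h and regularizing costs 2, whence 5/h^2 times a telescoping difference. *)
Lemma potential_le_ln_det (h lam : R) G rs : 0 < h < 1 / 2 -> 0 < lam -> psd G ->
    0 < \det (lam%:M + G) ->
    (forall k, (k <= size rs)%N ->
       spectral_gap lam (G + \sum_(a <- take k rs) sqr a)) ->
  potential h 0 0 (h *: G) rs <=
    5 * h^-1 ^+ 2 *
      (ln (\det (lam%:M + (G + \sum_(a <- rs) sqr a))) - ln (\det (lam%:M + G))).
Proof.
move=> /andP[h0 h1] lam0; elim: rs G => [|a rs IH] G pG d0 gap.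
  by rewrite big_nil addr0 subrr mulr0.
rewrite [potential _ _ _ _ _]/= !add0r -scalerDr big_cons (addrA G).
set M := G + sqr a.
have pM : psd M by apply: psdD => //; exact: psd_sqr.
have dM : 0 < \det (lam%:M + M).
  rewrite addrA (det_gt0_update _ lam0) //.
  by rewrite addrAC subrr add0r.
have aM : (a <= M)%MS by apply: submx_psd1 => //; rewrite addrK.
have gapS k : (k <= size rs)%N -> spectral_gap lam (M + \sum_(b <- take k rs) sqr b).
  by move=> hk; have := gap k.+1 hk; rewrite /= big_cons addrA.
have {}IH := IH M pM dM gapS.
have gapM : spectral_gap lam M by have := gap 1 isT; rewrite /= take0 big_seq1.
have hM : psd (h *: M) by apply: psdZ => //; exact: ltW.
have hN : psd (h *: G + sqr a).
  by apply: psdD; [apply: psdZ => //; exact: ltW|exact: psd_sqr].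
have l1 : lev (h *: G + sqr a) a <= h^-1 * lev M a.
  rewrite -lev_scale ?gt_eqF //; last by case: pM.
  apply: lev_anti => //.
  - have -> : h *: G + sqr a - h *: M = (1 - h) *: sqr a by rewrite /M; mxring.
    by apply: psdZ; [lra|exact: psd_sqr].
  - by rewrite eqmx_scale // gt_eqF.
  - by apply: submx_psd1 => //; rewrite addrK; apply: psdZ => //; exact: ltW.
have l2 := lev_regularize lam0 pM aM gapM.
have l3 := lev_le_ln_det a lam0 pG d0; rewrite -/M in l3.
set N := ln (\det (lam%:M + M)) in l3 IH.
set T := ln _ in IH *; set B := ln _ in l3 *.
have l4 : lev (h *: G + sqr a) a <= h^-1 * (2 * (N - B)).
  apply: le_trans l1 _; apply: ler_wpM2l; first by rewrite invr_ge0 ltW.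
  lra.
have l5 : 5 / 2 * h^-1 * lev (h *: G + sqr a) a <= 5 / 2 * h^-1 * (h^-1 * (2 * (N - B))).
  by apply: ler_wpM2l l4; rewrite mulr_ge0 ?invr_ge0 ?ltW //; lra.
have : 5 / 2 * h^-1 * (h^-1 * (2 * (N - B))) = 5 * h^-1 ^+ 2 * (N - B) by field; lra.
lra.
Qed.
End LogDet.

(** * Extremal singular values and the determinant of a Gram matrix *)

Section Extremal.
Context {m d : nat}.
Variable A : 'M[R]_(m, d).
Let G := A^T *m A.

Lemma psd_tr_mul : psd G.
Proof.
split=> [|x]; first by rewrite /sym /G trmx_mul trmxK.
suff -> : bil G x x = (x *m A^T *m (x *m A^T)^T) 0 0 by exact: dot_ge0.
by rewrite /bil /G trmx_mul trmxK !mulmxA.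
Qed.

Lemma bil_gram_eq0 : (forall x, bil G x x = 0) -> A = 0.
Proof.
move=> h; suff A0 : A^T = 0 by rewrite -[A]trmxK A0 trmx0.
apply/row_matrixP => i; rewrite rowE row0; apply: dot_eq0.
by have := h (delta_mx 0 i); rewrite /bil /G /dot trmx_mul trmxK !mulmxA.
Qed.

Lemma eigenvalue_ge0 c : eigenvalue G c -> 0 <= c.
Proof.
case/eigenvalueP => v vG v0; have [_ /(_ v)] := psd_tr_mul.
have vv := dot_gt0 v0.
by rewrite bil_dot vG dotZl pmulr_lge0.
Qed.

(** [spec_norm] is an [epsilon] choice, so a maximum must be exhibited: the root of the largest D i,
    which bounds every eigenvalue since each is a weighted average of the D i. *)
Lemma eigenvalue_le_spec_norm c : eigenvalue G c -> c <= spec_norm A ^+ 2.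
Proof.
move=> eG; have [sG _] := psd_tr_mul.
have [D [eD _ _ wD]] := symmetric_spectral sG.
have [i0 _] : exists i0 : 'I_d, True.
  case/eigenvalueP: eG => v _ v0; case: d v v0 {D eD wD sG} => [|k] v v0; last by exists ord0.
  by move: v0; rewrite thinmx0 eqxx.
pose im := [arg max_(i > i0) D i]%O.
have Dle i : D i <= D im by rewrite /im; case: arg_maxP => // j _; apply.
have D0 i : 0 <= D i by exact: eigenvalue_ge0.
have [[s0 _] smax] : singular_value A (spec_norm A) /\
    forall y, singular_value A y -> y <= spec_norm A.
  apply: (ClassicalEpsilon.epsilon_spec _
    (fun x => singular_value A x /\ forall y, singular_value A y -> y <= x)).
  exists (Num.sqrt (D im)); split.
    by split; rewrite ?sqrtr_ge0 // sqr_sqrtr.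
  move=> y [y0 /eigenvalueP[v vG v0]].
  have vv := dot_gt0 v0.
  rewrite -[y]ger0_norm // -sqrtr_sqr ler_wsqrtr //.
  have [w [w0 ww bw _]] := wD v.
  rewrite -(ler_pM2r vv) -dotZl -vG -bil_dot bw ww mulr_sumr.
  by apply: ler_sum => i _; rewrite mulrC; apply: ler_wpM2r.
have c0 := eigenvalue_ge0 eG.
rewrite -[c]sqr_sqrtr // lerXn2r ?nnegrE ?sqrtr_ge0 //.
by apply: smax; split; rewrite ?sqrtr_ge0 // sqr_sqrtr.
Qed.

(** The witness for the minimum is the root of the least nonzero D i. On the row space the weights
    of zero eigenvalues vanish, so Rayleigh quotients are at least that D i. *)
Lemma sigma_min_spec : A != 0 ->
  [/\ 0 < sigma_min A, eigenvalue G (sigma_min A ^+ 2) &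
      spectral_gap (sigma_min A ^+ 2) G].
Proof.
move=> A0; have [sG _] := psd_tr_mul.
have [D [eD _ _ wD]] := symmetric_spectral sG.
have D0 i : 0 <= D i by exact: eigenvalue_ge0.
have [i0 Di0] : exists i, D i != 0.
  apply/existsP; apply: contraNT A0; rewrite negb_exists => /forallP D00.
  apply/eqP/bil_gram_eq0 => x; have [w [_ _ -> _]] := wD x.
  by apply: big1 => i _; have := D00 i; rewrite negbK => /eqP ->; rewrite mulr0.
pose im := [arg min_(i < i0 | D i != 0) D i]%O.
have [imN0 Dge] : D im != 0 /\ forall i, D i != 0 -> D im <= D i.
  by rewrite /im; case: arg_minP => // j; split.
have gap : spectral_gap (D im) G.
  move=> x xG; have [w [w0 -> -> wz]] := wD x.
  rewrite mulr_sumr; apply: ler_sum => i _; rewrite mulrC.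
  have [Di|Di] := eqVneq (D i) 0; first by rewrite (wz xG i Di) !mul0r.
  by apply: ler_wpM2l => //; exact: Dge.
have [[[s0 es] sp] smin] : (singular_value A (sigma_min A) /\ 0 < sigma_min A) /\
    forall y, singular_value A y /\ 0 < y -> sigma_min A <= y.
  apply: (ClassicalEpsilon.epsilon_spec _
    (fun x => (singular_value A x /\ 0 < x) /\
      forall y, singular_value A y /\ 0 < y -> x <= y)).
  exists (Num.sqrt (D im)); split.
    split; first by split; rewrite ?sqrtr_ge0 // sqr_sqrtr.
    by rewrite sqrtr_gt0 lt_neqAle eq_sym imN0 D0.
  move=> y [[y0 /eigenvalueP[v vG v0]] yp].
  have vv := dot_gt0 v0.
  rewrite -[y]ger0_norm // -sqrtr_sqr ler_wsqrtr //.
  rewrite -(ler_pM2r vv) -[leRHS]dotZl -vG -bil_dot; apply: gap.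
  (* An eigenvector with nonzero eigenvalue lies in the row space, so the gap applies to it. *)
  have -> : v = (y ^+ 2)^-1 *: (v *m G).
    by rewrite vG scalerA mulVf ?scale1r // expf_neq0 // gt_eqF.
  by rewrite scalemx_sub // submxMl.
split=> // x xG; apply: le_trans (gap x xG); apply: ler_wpM2r; first exact: dot_ge0.
rewrite -[D im]sqr_sqrtr // lerXn2r ?nnegrE ?sqrtr_ge0 //.
apply: smin; split; first by split; rewrite ?sqrtr_ge0 // sqr_sqrtr.
by rewrite sqrtr_gt0 lt_neqAle eq_sym imN0 D0.
Qed.

(** The ratio of determinants is the product of the 1 + D i / lam. Zero eigenvalues contribute 1,
    and each of the others, at most rank A in number, is bounded through the spectral norm. *)
Lemma ln_det_gram_le lam : 0 < lam ->
  ln (\det (lam%:M + G)) - ln (\det (lam%:M + (0 : 'M[R]_d))) <=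
    (\rank A)%:R * ln (1 + spec_norm A ^+ 2 / lam)%R.
Proof.
set r := spec_norm A ^+ 2 / lam => lam0; have [sG _] := psd_tr_mul.
have [D [eD detD rkD _]] := symmetric_spectral sG.
have D0 i : 0 <= D i by exact: eigenvalue_ge0.
rewrite detD addr0 det_scalar.
have -> : \prod_i (lam + D i) = lam ^+ d * \prod_i (1 + D i / lam).
  rewrite -[X in lam ^+ X]card_ord -prodr_const -big_split /=; apply: eq_bigr => i _.
  by field; rewrite gt_eqF.
have r0 : 0 <= r by rewrite divr_ge0 ?sqr_ge0 // ltW.
have Dr0 i : 0 < 1 + D i / lam by rewrite ltr_pwDl // divr_ge0 // ltW.
have P0 : 0 < \prod_i (1 + D i / lam) by apply: prodr_gt0.
rewrite ln_mul // ?exprn_gt0 //.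
have : \prod_i (1 + D i / lam) <= (1 + r) ^+ \rank A.
  rewrite (bigID (fun i => D i != 0)) /= [X in _ * X]big1 ?mulr1; last first.
    by move=> i; rewrite negbK => /eqP ->; rewrite mul0r addr0.
  have r1 : 1 <= 1 + r by rewrite lerDl.
  have rkG : (#|[pred i | D i != 0%R]| <= \rank A)%N.
    by apply: leq_trans rkD _; exact: mxrankM_maxr.
  apply: le_trans (ler_weXn2l r1 rkG); rewrite -prodr_const.
  apply: ler_prod => i _; rewrite ltW ?Dr0 //= lerD2l ler_pM2r ?invr_gt0 //.
  exact: eigenvalue_le_spec_norm.
move=> /(ln_homo P0); have -> : ln ((1 + r) ^+ \rank A)%R = (\rank A)%:R * ln (1 + r)%R.
  have r1 : 0 < 1 + r by rewrite ltr_pwDl.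
  elim: (\rank A) => [|k IH]; first by rewrite mul0r; exact: ln_1.
  by rewrite exprS ln_mul ?exprn_gt0 // IH -natr1; ring.
by rewrite addrAC subrr add0r.
Qed.
End Extremal.

(** * Prefixes of the input matrix and the final bound *)

Lemma gram_first_rows n d (A : 'M[R]_(n, d)) (i : 'I_n.+1) :
  \sum_(a <- take i (rows_of A)) sqr a = (first_rows A i)^T *m first_rows A i.
Proof.
have si : (i <= n)%N by rewrite -ltnS.
have sz : size (rows_of A) = n by rewrite size_map size_enum_ord.
apply/matrixP => p q; rewrite mxE summxE (big_nth 0) size_take sz.
have -> : (if (i < n)%N then i : nat else n) = i.
  by case: ltnP => // ni; apply/eqP; rewrite eqn_leq ni si.
rewrite big_mkord; apply: eq_bigr => k _.
have kn : (k < n)%N by apply: leq_trans si.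
rewrite nth_take // (nth_map (widen_ord si k)) ?size_enum_ord //.
have -> : nth (widen_ord si k) (enum 'I_n) k = widen_ord si k.
  by apply: val_inj; rewrite /= nth_enum_ord.
rewrite !mxE big_ord1 !mxE.
by rewrite (bool_irrelevance si (ltn_ord i : (i <= n)%N)).
Qed.

(** Prefixes are finitely many, so the minimum is attained; a zero prefix has a trivial row space
    and satisfies any gap. The full prefix [ord_max] gives the last inequality, that is mu(A) >=
    1. *)
Lemma min_first_rows_spec n d (A : 'M[R]_(n, d)) : A != 0 ->
  let lam := min_of (fun v => exists i : 'I_n.+1,
    first_rows A i != 0 /\ v = sigma_min (first_rows A i) ^+ 2) in
  [/\ 0 < lam, forall i, spectral_gap lam ((first_rows A i)^T *m first_rows A i) &
      lam <= spec_norm A ^+ 2].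
Proof.
move=> A0; set Q := fun v => _; cbv zeta.
have Afull : (first_rows A ord_max)^T *m first_rows A ord_max = A^T *m A.
  rewrite -gram_first_rows gram_rows take_oversize //.
  by rewrite size_map size_enum_ord.
have i0 : first_rows A ord_max != 0.
  apply: contra A0 => /eqP A0; rewrite A0 mulmx0 in Afull.
  by apply/eqP/bil_gram_eq0 => x; rewrite -Afull bil0.
pose f i := sigma_min (first_rows A i) ^+ 2.
have : exists v, Q v /\ forall w, Q w -> v <= w.
  exists (f [arg min_(i < ord_max | first_rows A i != 0) f i]%O).
  case: arg_minP => // i iN0 imin; split; first by exists i.
  by move=> w [j [jN0 ->]]; exact: imin.
move=> /(ClassicalEpsilon.epsilon_spec (inhabits 0)); rewrite -/(min_of Q).
set lam := min_of Q => -[[i [iN0 lamE]] lam_min].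
split.
- by rewrite lamE exprn_gt0 //; case: (sigma_min_spec iN0).
- move=> j x xG; have [jE|jN0] := eqVneq (first_rows A j) 0.
    move: xG; rewrite jE mulmx0 submx0 => /eqP ->.
    by rewrite dot0l mulr0 bil0.
  have [_ _ gap] := sigma_min_spec jN0; apply: le_trans (gap x xG).
  by apply: ler_wpM2r; [exact: dot_ge0|apply: lam_min; exists j].
- have [_ eS _] := sigma_min_spec i0; rewrite Afull in eS.
  apply: le_trans (eigenvalue_le_spec_norm eS).
  by apply: lam_min; exists ord_max.
Qed.

(** Both gaps start at 0, so the potential starts from zero matrices; with h = eps/2 the factor
    5/h^2 becomes 20/eps^2. *)
Lemma expected_rows_le_ln_det n d (A : 'M[R]_(n, d)) (eps lam : R) :
    0 < eps < 1 -> 0 < lam ->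
    (forall i, spectral_gap lam ((first_rows A i)^T *m first_rows A i)) ->
  expected_rows eps (init_state d) (rows_of A) <=
    20 * eps ^- 2 *
      (ln (\det (lam%:M + A^T *m A)) - ln (\det (lam%:M + (0 : 'M[R]_d)))).
Proof.
move=> e01 lam0 gap; have /andP[e0 e1] := e01.
have h12 : 0 < eps / 2 < 1 / 2 by apply/andP; split; lra.
have gapU0 : gapU (init_state d) = 0 by rewrite /gapU gramE big_nil subrr.
have gapL0 : gapL (init_state d) = 0 by rewrite /gapL gramE big_nil subrr.
have g0 : good (init_state d) by split; rewrite ?gapU0 ?gapL0; exact: psd0.
apply: le_trans (expected_rows_le_potential e01 _ g0) _.
rewrite gapU0 gapL0 add0r.
have d0 : 0 < \det (lam%:M + (0 : 'M[R]_d)) by rewrite addr0 det_scalar exprn_gt0.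
have gaps k : (k <= size (rows_of A))%N ->
    spectral_gap lam (0 + \sum_(a <- take k (rows_of A)) sqr a).
  rewrite add0r size_map size_enum_ord -ltnS => kn.
  by have := gap (Ordinal kn); rewrite -gram_first_rows.
have := potential_le_ln_det h12 lam0 psd0 d0 gaps.
rewrite scaler0 add0r -gram_rows => /le_trans; apply.
rewrite le_eqVlt; apply/orP; left; apply/eqP; congr (_ * _).
by field; rewrite gt_eqF.
Qed.

Theorem mainTheorem2 :
  exists C : R, 0 < C /\
  forall (n d : nat) (A : 'M[R]_(n, d)) (eps : R), 0 < eps < 1 ->
    almost_surely (fun s => spectral_approx (stack s) A eps)
                  eps (init_state d) (rows_of A) /\
    expected_rows eps (init_state d) (rows_of A)
      <= C * ((\rank A)%:R * eps ^- 2 * ln (mu A) + (\rank A)%:R * eps ^- 2).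
Proof.
exists 20; split; first by lra.
move=> n d A eps e01; split.
  apply: (@almost_surely_gram _ _ e01 _ _ 0).
  - by split; rewrite /gapU /gapL /= gramE big_nil subrr; exact: psd0.
  - by rewrite scaler0.
  - by rewrite scaler0.
  move=> s; cbv zeta; rewrite add0r -gram_rows => -[_ pU] [_ pL].
  by split=> x; [exact: pL|exact: pU].
(* For A = 0 the minimum in [mu] ranges over an empty set and is unspecified, but the rank factor
   makes the bound 0; lam = 1 serves as a gap. *)
have [->|A0] := eqVneq A 0.
  rewrite mxrank0 !mul0r addr0 mulr0.
  have gap (i : 'I_n.+1) : spectral_gap 1
      ((first_rows (0 : 'M[R]_(n, d)) i)^T *m first_rows (0 : 'M[R]_(n, d)) i).
    have -> : first_rows (0 : 'M[R]_(n, d)) i = 0 by apply/matrixP => p q; rewrite !mxE.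
    by move=> x; rewrite mulmx0 submx0 => /eqP ->; rewrite dot0l mulr0 bil0.
  by have := expected_rows_le_ln_det e01 ltr01 gap; rewrite mulmx0 subrr mulr0.
have := min_first_rows_spec A0; rewrite /mu; set lam := min_of _ => -[lam0 gap lamL].
rewrite RdivE ?gt_eqF //; set r := spec_norm A ^+ 2 / lam.
have r1 : 1 <= r by rewrite ler_pdivlMr // mul1r.
apply: le_trans (expected_rows_le_ln_det e01 lam0 gap) _.
have e2 : 0 <= eps ^- 2 by rewrite invr_ge0 exprn_ge0 // ltW //; case/andP: e01.
have -> : 20 * ((\rank A)%:R * eps ^- 2 * ln r + (\rank A)%:R * eps ^- 2) =
  20 * eps ^- 2 * ((\rank A)%:R * (1 + ln r)) by ring.
apply: ler_wpM2l; first by rewrite mulr_ge0.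
apply: le_trans (ln_det_gram_le A lam0) _; apply: ler_wpM2l; first exact: ler0n.
have rp : 0 < r by lra.
(* As r >= 1, 1 + r is at most 2 r, and ln 2 <= 1 supplies the additive rank term. *)
have h2 : ln (1 + r)%R <= ln (2 * r)%R by apply: ln_homo; lra.
apply: le_trans h2 _; rewrite ln_mul // lerD2r.
have /ln_le_sub1 : 0 < 2%:R :> R by rewrite ltr0n.
lra.
Qed.
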